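(* Let $(T(t))_{t\ge 0}$ be a positive $C_0$-semigroup on a Banach lattice $X$ with order continuous norm, and let $X_{-1}$ be the associated extrapolation space, ordered by the cone $X_{-1,+}:=\overline{X_+}^{X_{-1}}$. Then $\operatorname{span}(X_{-1,+})$ is a Banach lattice with order continuous norm with respect to a norm equivalent to $\|\cdot\|_{\operatorname{span}(X_{-1,+})}$. Moreover, the canonical embedding of $X$ into $\operatorname{span}(X_{-1,+})$ is a lattice homomorphism and $X$ is a lattice ideal in $\operatorname{span}(X_{-1,+})$. If $X$ is a KB-space, then so is $\operatorname{span}(X_{-1,+})$.
   Context: All spaces are real (spectra are understood via complexification). A cone in a real vector space $X$ is a non-empty set $X_+\subseteq X$ with $\alpha X_+ + \beta X_+ \subseteq X_+$ for all real $\alpha,\beta\ge 0$ and $X_+\cap(-X_+)=\{0\}$; it induces the order $x\le y :\Leftrightarrow y-x\in X_+$. An ordered Banach space is a Banach space with a norm-closed cone. For an ordered Banach space $Z$ one has $\operatorname{span}(Z_+)=Z_+-Z_+$; this space is ordered by the cone $Z_+$ and endowed with the complete norm $$\|x\|_{\operatorname{span}(Z_+)} := \inf\{\|y\|+\|z\| : y,z\in Z_+,\ x=y-z\}.$$ A vector lattice is an ordered vector space in which any two elements have a supremum; $|x|:=\sup\{x,-x\}$. A Banach lattice is an ordered Banach space that is a vector lattice such that $|x|\le|y|$ implies $\|x\|\le\|y\|$. A Banach lattice $X$ has order continuous norm if every increasing and order bounded net (equivalently, sequence) in $X_+$ is norm convergent. A KB-space is a Banach lattice in which every increasing norm-bounded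 net (equivalently, sequence) is norm-convergent. A subspace $I$ of a vector lattice $Z$ is a lattice ideal if $|x|\le|y|$ with $x \in Z$, $y\in I$ implies $x\in I$. A $C_0$-semigroup $(T(t))_{t\ge0}$ on $X$ is positive if $T(t)X_+\subseteq X_+$ for every $t\ge 0$. Let $A$ be its generator and fix a real number $\lambda$ larger than the real part of every spectral value of $A$. The extrapolation space $X_{-1}$ is the completion of $X$ with respect to the norm $\|x\|_{-1}:=\|(\lambda-A)^{-1}x\|_X$; up to equivalent norms it does not depend on $\lambda$, and $X$ embeds canonically (continuously, densely, injectively) into $X_{-1}$. The set $X_{-1,+}$ is defined as the closure of $X_+$ in $X_{-1}$. It is known that $X_{-1,+}$ is a cone in $X_{-1}$ and that $X_{-1,+}\cap X=X_+$. *)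

(* Defs.v *)
From HB Require Import structures.
From mathcomp Require Import all_boot all_order all_algebra.
From mathcomp Require Import all_classical all_reals all_analysis.
From mathcomp Require Import complex.

Set Implicit Arguments.
Unset Strict Implicit.
Unset Printing Implicit Defensive.

Import Order.TTheory GRing.Theory Num.Theory.
Import numFieldNormedType.Exports.

Local Open Scope classical_set_scope.
Local Open Scope ring_scope.

Section OrderedVectorSpace.
Context {R : realType} {V : lmodType R}.
Implicit Types (C I : set V) (x y s : V).

Definition is_cone C : Prop :=
  [/\ C !=set0,
      forall (a b : R) x y, 0 <= a -> 0 <= b -> C x -> C y ->
        C (a *: x + b *: y)
    & C `&` [set - x | x in C] = [set 0]].

Definition cone_le C x y : Prop := C (y - x).

Definition is_sup C x y s : Prop :=
  [/\ cone_le C x s, cone_le C y s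
    & forall u, cone_le C x u -> cone_le C y u -> cone_le C s u].

Definition vector_lattice C : Prop :=
  is_cone C /\ forall x y, exists s, is_sup C x y s.

(* The supremum is unique when it exists; junk value 0 otherwise. *)
Definition vsup C x y : V := xget 0 [set s | is_sup C x y s].

Definition vabs C x : V := vsup C x (- x).

Definition is_subspace I : Prop :=
  I 0 /\ forall (a : R) x y, I x -> I y -> I (a *: x + y).

Definition lattice_ideal C I : Prop :=
  is_subspace I /\
  forall x y, cone_le C (vabs C x) (vabs C y) -> I y -> I x.

Definition lin_span C : set V := smallest is_subspace C.

Lemma lin_span_is_subspace C : is_subspace (lin_span C).
Proof.
split=> [M [[]]//|a x y Sx Sy M MC].
by case: (MC) => -[_ +] _; apply; [exact: Sx|exact: Sy].
Qed.

Lemma lin_spanE C : is_cone C ->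
  lin_span C = [set x | exists y z, [/\ C y, C z & x = y - z]].
Proof.
move=> [[c Cc] Ccomb _].
have C0 : C 0 by have := Ccomb 0 0 _ _ (lexx _) (lexx _) Cc Cc; rewrite !scale0r addr0.
have CZ a x : 0 <= a -> C x -> C (a *: x).
  by move=> a0 Cx; have := Ccomb a 0 _ _ a0 (lexx _) Cx Cx; rewrite scale0r addr0.
have CD x y : C x -> C y -> C (x + y).
  by move=> Cx Cy; have := Ccomb 1 1 _ _ ler01 ler01 Cx Cy; rewrite !scale1r.
apply/seteqP; split.
  apply: smallest_sub => [|x Cx]; last by exists x, 0; rewrite subr0.
  split=> [|a _ _ [y [z [Cy Cz ->]]] [y' [z' [Cy' Cz' ->]]]].
    by exists 0, 0; rewrite subr0.
  have [a0|/ltW a0] := leP 0 a.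
    exists (a *: y + y'), (a *: z + z'); split; [exact/CD/Cy'/CZ|exact/CD/Cz'/CZ|].
    by rewrite scalerBr opprD addrACA.
  have Na0 : 0 <= - a by rewrite oppr_ge0.
  exists (- a *: z + y'), (- a *: y + z').
  split; [exact/CD/Cy'/CZ|exact/CD/Cz'/CZ|].
  by rewrite opprD addrACA !scaleNr opprK scalerBr [- _ + _]addrC.
move=> _ [y [z [Cy Cz ->]]] M [SM CM].
by rewrite addrC -scaleN1r; apply: SM.2; exact: CM.
Qed.

End OrderedVectorSpace.

Definition lattice_hom {R : realType} {V W : lmodType R} (C : set V)
    (D : set W) (f : {linear V -> W}) : Prop :=
  forall x y, f (vsup C x y) = vsup D (f x) (f y).

Section SpanSpace.
Context {R : realType} {V : lmodType R}.

Definition span_space (C : set V) : Type := {x : V | x \in lin_span C}.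

Variable C : set V.

HB.instance Definition _ := SubChoice.on (span_space C).

Fact lin_span_submod_closed : submod_closed (mem (lin_span C)).
Proof.
have [S0 SZ] := lin_span_is_subspace C.
by split=> [|a x y]; rewrite !inE//; exact: SZ.
Qed.

HB.instance Definition _ := GRing.SubChoice_isSubLmodule.Build
  R V (fun x => x \in lin_span C) (span_space C) lin_span_submod_closed.

Definition span_cone : set (span_space C) := [set x | C (\val x)].

End SpanSpace.

Arguments span_cone {R V} C _.

Definition span_norm {R : realType} {Z : normedModType R} (C : set Z)
    (x : span_space C) : R :=
  inf [set r | exists y z, [/\ C y, C z, \val x = y - z & r = `|y| + `|z| ]].

Arguments span_norm {R Z} C x.

Section Renorming.
Context {R : realType} {V : lmodType R}.

Definition is_norm (N : V -> R) : Prop :=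
  [/\ forall x y, N (x + y) <= N x + N y,
      forall (a : R) x, N (a *: x) = `|a| * N x
    & forall x, N x = 0 -> x = 0].

Definition equivalent_norms (N N' : V -> R) : Prop :=
  exists a b : R, [/\ 0 < a, 0 < b & forall x, N x <= a * N' x /\ N' x <= b * N x].

(* V with the topology and norm given by N. *)
Definition renormed (N : V -> R) (HN : is_norm N) : Type := V.

Variables (N : V -> R) (HN : is_norm N).

HB.instance Definition _ := GRing.Lmodule.on (renormed HN).

Let renormedD (x y : renormed HN) : N (x + y) <= N x + N y.
Proof. by have [] := HN. Qed.
Let renormedZ (a : R) (x : renormed HN) : N (a *: x) = `|a| * N x.
Proof. by have [] := HN. Qed.
Let renormed0 (x : renormed HN) : N x = 0 -> x = 0.
Proof. by have [_ _] := HN; exact. Qed.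

HB.instance Definition _ :=
  Lmodule_isNormed.Build R (renormed HN) renormedD renormedZ renormed0.

End Renorming.

Section Nets.
Context {I : Type} (le : I -> I -> Prop).

Definition directed : Prop :=
  [/\ [set: I] !=set0, forall i, le i i,
      forall i k l, le i k -> le k l -> le i l
    & forall i k, exists l, le i l /\ le k l].

(* A net (u i) indexed by (I, le) converges to x iff u @ tails --> x. *)
Definition tails : set_system I := filter_from setT (fun i => [set k | le i k]).

Definition increasing_net {R : realType} {V : lmodType R} (C : set V)
    (u : I -> V) : Prop :=
  forall i k, le i k -> cone_le C (u i) (u k).

End Nets.

Section BanachLattice.
Context {R : realType}.

Definition ordered_banach_space (E : normedModType R) (C : set E) : Prop :=
  [/\ forall F : set_system E, ProperFilter F -> cauchy F -> cvg F,
      is_cone C & closed C].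

Definition banach_lattice (E : normedModType R) (C : set E) : Prop :=
  [/\ ordered_banach_space C, vector_lattice C
    & forall x y, cone_le C (vabs C x) (vabs C y) -> `|x| <= `|y| ].

Definition order_continuous_norm (E : normedModType R) (C : set E) : Prop :=
  forall (I : Type) (le : I -> I -> Prop) (u : I -> E),
    directed le -> increasing_net le C u -> (forall i, C (u i)) ->
    (exists a b, forall i, cone_le C a (u i) /\ cone_le C (u i) b) ->
    cvg (u @ tails le).

Definition KB_space (E : normedModType R) (C : set E) : Prop :=
  banach_lattice C /\
  forall (I : Type) (le : I -> I -> Prop) (u : I -> E),
    directed le -> increasing_net le C u -> bounded_set (range u) ->
    cvg (u @ tails le).

End BanachLattice.

Section Semigroup.
Context {R : realType} {X : completeNormedModType R}.
Variable T : R -> {linear X -> X}.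

(* Only the values T t with 0 <= t are constrained, here and below. *)
Definition C0_semigroup : Prop :=
  [/\ forall t, 0 <= t -> continuous (T t),
      forall x, T 0 x = x,
      forall s t x, 0 <= s -> 0 <= t -> T (s + t) x = T s (T t x)
    & forall x, {within `[0, +oo[, continuous (fun t => T t x)}].

Definition positive_semigroup (Xp : set X) : Prop :=
  forall t x, 0 <= t -> Xp x -> Xp (T t x).

Definition gen_dom : set X :=
  [set x | cvg (h^-1 *: (T h x - x) @[h --> (0 : R)^'+])].

Definition gen (x : X) : X := lim (h^-1 *: (T h x - x) @[h --> (0 : R)^'+]).

(* A pair (x, y) stands for the vector x + i y of the complexification of X,
   on which the generator acts componentwise; this is z - A. *)
Definition complex_sub_gen (z : R[i]) (u : X * X) : X * X :=
  (complex.Re z *: u.1 - complex.Im z *: u.2 - gen u.1,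
   complex.Re z *: u.2 + complex.Im z *: u.1 - gen u.2).

Definition gen_resolvent_set : set R[i] :=
  [set z | exists B : X * X -> X * X,
    [/\ continuous B,
        forall u, gen_dom (B u).1 /\ gen_dom (B u).2,
        forall u, complex_sub_gen z (B u) = u
      & forall u, gen_dom u.1 -> gen_dom u.2 -> B (complex_sub_gen z u) = u]].

Definition gen_spectrum : set R[i] := ~` gen_resolvent_set.

Definition gen_resolvent (lambda : R) (x : X) : X :=
  xget 0 [set y | gen_dom y /\ lambda *: y - gen y = x].

(* (Z, j) is a completion of X for the norm x |-> `|(lambda - A)^-1 x|; such a
   completion is unique up to isometric isomorphism. *)
Definition extrapolation_space (lambda : R) (Z : completeNormedModType R)
    (j : {linear X -> Z}) : Prop :=
  (forall x, `|j x| = `|gen_resolvent lambda x| ) /\ dense (range j).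

End Semigroup.

(* Main.v *)
(**
  Write [R_mu] for the resolvent of the generator. For large [mu] it is positive,
  and it extends to a positive operator [E] that embeds the extrapolation space
  [Z] into [X] with equivalence of norms. Monotone nets in [Z] that are order
  bounded, or norm bounded in the KB case, are therefore mapped by [E] to
  convergent nets of [X], hence converge. The lattice norm on the span of the
  cone is [N z = `|E |z||], for which this argument also gives order continuity
  and the KB property.

  With [P n = n R_(mu + n)], which maps [Z] to [X] and converges strongly to the
  identity, the positive part of [z] is the limit of [(P n z)^+]: since [P m] is
  positive and commutes with [P n], and [E P m <= E], the sequence
  [E ((P n z)^+)] is increasing up to vanishing errors.

  For the ideal property let [0 <= z <= j x]. The positive parts of [z - j c],
  [c] in [X], are obtained both from [P n z] and from the mean of [P n z] and
  [P m z], so in the limit [P n z] and [P m z] cannot lie on different sides of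
  [c]. Applied to the finitely many multiples [c] of [x / k] below [x], this
  makes [P n z] a Cauchy sequence of [X].

  Vector-valued integrals are avoided: the resolvent exists by hypothesis, and
  its positivity and the convergence of [P n] follow from a mean value inequality
  for right derivatives applied to the damped orbits of the semigroup.
*)
Require Import Defs.
From HB Require Import structures.
From mathcomp Require Import all_boot all_order all_algebra.
From mathcomp Require Import all_classical all_reals all_analysis.
From mathcomp Require Import complex.
From mathcomp Require Import ring lra.

Set Implicit Arguments.
Unset Strict Implicit.
Unset Printing Implicit Defensive.

Import Order.TTheory GRing.Theory Num.Theory.
Import numFieldNormedType.Exports.

Local Open Scope classical_set_scope.
Local Open Scope ring_scope.

(** * Identities in abelian groups *)

(** Reified terms for the reflexive tactic [abel], which proves an identity between sums and
    opposites by comparing the integer coefficient of each atom on the two sides. *)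
Inductive zexpr := ZVar of nat | ZZero | ZAdd of zexpr & zexpr | ZOpp of zexpr.

Fixpoint zeval (V : zmodType) (env : seq V) e : V :=
  match e with
  | ZVar i => nth 0 env i
  | ZZero => 0
  | ZAdd a b => zeval env a + zeval env b
  | ZOpp a => - zeval env a
  end.

Fixpoint zcoef e (i : nat) : int :=
  match e with
  | ZVar k => if k == i then 1 else 0
  | ZZero => 0
  | ZAdd a b => zcoef a i + zcoef b i
  | ZOpp a => - zcoef a i
  end.

Lemma zevalE (V : zmodType) (env : seq V) e :
  zeval env e = \sum_(i < size env) nth 0 env i *~ zcoef e i.
Proof.
elim: e => [k||a IHa b IHb|a IHa] /=.
- have [k_lt|k_ge] := ltnP k (size env).
    rewrite (bigD1 (Ordinal k_lt))//= eqxx big1 ?addr0// => i /negPf ik.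
    by rewrite ifN// eq_sym -[k]/(val (Ordinal k_lt)) val_eqE ik.
  rewrite nth_default// big1// => i _.
  by rewrite ifN// neq_ltn (leq_trans (ltn_ord i) k_ge) orbT.
- by rewrite big1.
- by rewrite IHa IHb -big_split; apply: eq_bigr => i _; rewrite mulrzDr.
- by rewrite IHa -sumrN; apply: eq_bigr => i _; rewrite mulrNz.
Qed.

Lemma zeval_eq (V : zmodType) (env : seq V) e1 e2 :
  all (fun i => zcoef e1 i == zcoef e2 i) (iota 0 (size env)) ->
  zeval env e1 = zeval env e2.
Proof.
move=> /allP e12; rewrite !zevalE; apply: eq_bigr => i _.
by rewrite (eqP (e12 _ _))// mem_iota /= add0n.
Qed.

(** Atoms are identified up to unification; differences are covered because [a - b] is a notation
    for [a + - b]. *)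
Ltac zatoms t acc :=
  lazymatch t with
  | (?a + ?b)%R => let acc := zatoms a acc in zatoms b acc
  | (- ?a)%R => zatoms a acc
  | (0)%R => acc
  | _ => let rec mem l := match l with
           | [::] => constr:(t :: acc)
           | ?a :: _ => let _ := match goal with _ => unify a t end in acc
           | _ :: ?l' => mem l' end
         in mem acc
  end.

Ltac zindex t l :=
  match l with
  | ?a :: _ => let _ := match goal with _ => unify a t end in constr:(0%N)
  | _ :: ?l' => let n := zindex t l' in constr:(n.+1)
  end.

Ltac zquote t env :=
  lazymatch t with
  | (?a + ?b)%R =>
      let a := zquote a env in let b := zquote b env in constr:(ZAdd a b)
  | (- ?a)%R => let a := zquote a env in constr:(ZOpp a)
  | (0)%R => constr:(ZZero)
  | _ => let n := zindex t env in constr:(ZVar n)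
  end.

Ltac abel :=
  lazymatch goal with
  | |- ?l = ?r :> ?T =>
      let env := zatoms l (@nil T) in
      let env := zatoms r env in
      let a := zquote l env in
      let b := zquote r env in
      refine (@zeval_eq _ env a b _); vm_compute; reflexivity
  end.

(** * Vector lattices *)

Section VectorLattice.
Context {R : realType} {V : lmodType R} {C : set V} (coneC : is_cone C).
Implicit Types (x y z u v w s d : V) (a : R).

Local Notation "x ⪯ y" := (cone_le C x y) (at level 70).

Lemma cone0 : C 0.
Proof.
have [[c Cc] CZD _] := coneC.
by have := CZD 0 0 c c (lexx _) (lexx _) Cc Cc; rewrite !scale0r addr0.
Qed.

Lemma coneD x y : C x -> C y -> C (x + y).
Proof.
have [_ CZD _] := coneC => Cx Cy.
by have := CZD 1 1 x y ler01 ler01 Cx Cy; rewrite !scale1r.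
Qed.

Lemma coneZ a x : 0 <= a -> C x -> C (a *: x).
Proof.
have [_ CZD _] := coneC => a0 Cx.
by have := CZD a 0 x x a0 (lexx _) Cx Cx; rewrite scale0r addr0.
Qed.

Lemma coneMn x n : C x -> C (x *+ n).
Proof. by move=> Cx; rewrite -scaler_nat; exact: coneZ. Qed.

Lemma cone_anti x : C x -> C (- x) -> x = 0.
Proof.
have [_ _ C0] := coneC => Cx CNx.
suff: (C `&` [set - x | x in C]) x by rewrite C0.
by split=> //; exists (- x) => //; rewrite opprK.
Qed.

Lemma cone_ge0 x : C x -> 0 ⪯ x.
Proof. by rewrite /cone_le subr0. Qed.

Lemma cone_le0 x : 0 ⪯ x -> C x.
Proof. by rewrite /cone_le subr0. Qed.

Lemma cone_lexx x : x ⪯ x.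
Proof. by rewrite /cone_le subrr; exact: cone0. Qed.

Lemma cone_le_trans y x z : x ⪯ y -> y ⪯ z -> x ⪯ z.
Proof.
rewrite /cone_le => xy yz; have := coneD xy yz; congr C; abel.
Qed.

Lemma cone_le_anti x y : x ⪯ y -> y ⪯ x -> x = y.
Proof.
rewrite /cone_le => xy yx; apply/eqP; rewrite eq_sym -subr_eq0.
by apply/eqP/(cone_anti xy); rewrite opprB.
Qed.

Lemma cone_leD x y z u : x ⪯ y -> z ⪯ u -> x + z ⪯ y + u.
Proof.
rewrite /cone_le => xy zu; have := coneD xy zu; congr C; abel.
Qed.

Lemma cone_leB x y z u : x ⪯ y -> z ⪯ u -> x - u ⪯ y - z.
Proof.
rewrite /cone_le => xy zu; have := coneD xy zu; congr C; abel.
Qed.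

Lemma cone_le_subr x y z : x ⪯ y + z -> x - z ⪯ y.
Proof. by rewrite /cone_le => h; move: h; congr C; abel. Qed.

Lemma cone_le_add x y : C y -> x ⪯ x + y.
Proof. by rewrite /cone_le addrC addKr. Qed.

Lemma cone_leZ a x y : 0 <= a -> x ⪯ y -> a *: x ⪯ a *: y.
Proof. by rewrite /cone_le -scalerBr => a0; exact: coneZ. Qed.

Lemma is_sup_unique x y s u : is_sup C x y s -> is_sup C x y u -> s = u.
Proof.
by move=> [xs ys smin] [xu yu umin]; apply: cone_le_anti; [exact: smin|exact: umin].
Qed.

Lemma vsup_eq x y s : is_sup C x y s -> vsup C x y = s.
Proof.
by move=> sups; rewrite /vsup; case: xgetP => [u _ /= /is_sup_unique|/(_ s)//]; exact.
Qed.

(** Suprema are translation invariant, so the supremum of [x] and [y] is [y] plus that of [x - y]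
    and [0]. *)
Lemma vector_lattice_of_pos :
  (forall x, exists s, is_sup C x 0 s) -> vector_lattice C.
Proof.
move=> sup0; split=> // x y; have [s [xs s0 smin]] := sup0 (x - y).
exists (y + s); split.
- by move: xs; rewrite /cone_le; congr C; abel.
- by move: s0; rewrite /cone_le; congr C; abel.
- move=> u xu yu; have : s ⪯ u - y.
    apply: smin; first by move: xu; rewrite /cone_le; congr C; abel.
    by move: yu; rewrite /cone_le subr0.
  by rewrite /cone_le; congr C; abel.
Qed.

End VectorLattice.

Definition vpos {R : realType} {V : lmodType R} (C : set V) (x : V) : V :=
  vsup C x 0.

(** The classical identity for the infimum serves as its definition, so that infima reduce to
    positive parts. *)
Definition vinf {R : realType} {V : lmodType R} (C : set V) (x y : V) : V :=
  x - vpos C (x - y).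

Section VectorLatticeTheory.
Context {R : realType} {V : lmodType R} {C : set V} (latC : vector_lattice C).
Implicit Types (x y z u v w s d : V) (a : R).

Local Notation "x ⪯ y" := (cone_le C x y) (at level 70).
Local Notation pos := (vpos C).
Local Notation abs := (vabs C).

Let coneC : is_cone C. Proof. by case: latC. Qed.
Local Notation le_trans := (cone_le_trans coneC).

Lemma vsupP x y : is_sup C x y (vsup C x y).
Proof.
by rewrite /vsup; case: xgetP => // none; have [s /none] := latC.2 x y.
Qed.

Lemma le_vsupl x y : x ⪯ vsup C x y. Proof. by case: (vsupP x y). Qed.

Lemma le_vsupr x y : y ⪯ vsup C x y. Proof. by case: (vsupP x y). Qed.

Lemma vsup_le x y u : x ⪯ u -> y ⪯ u -> vsup C x y ⪯ u.
Proof. by case: (vsupP x y) => _ _; exact. Qed.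

Lemma vpos_ge0 x : C (pos x).
Proof. by apply: cone_le0; exact: le_vsupr. Qed.

Lemma le_vpos x : x ⪯ pos x. Proof. exact: le_vsupl. Qed.

Lemma vpos_le x u : x ⪯ u -> C u -> pos x ⪯ u.
Proof. by move=> xu Cu; apply: vsup_le => //; exact: cone_ge0. Qed.

Lemma vpos_id x : C x -> pos x = x.
Proof.
move=> Cx; apply: (cone_le_anti coneC); last exact: le_vpos.
by apply: vpos_le => //; exact: cone_lexx.
Qed.

Lemma vposD x y : pos (x + y) ⪯ pos x + pos y.
Proof.
by apply: vpos_le; [apply: cone_leD => //; exact: le_vpos|
  apply: coneD => //; exact: vpos_ge0].
Qed.

Lemma vposN x : pos (- x) = pos x - x.
Proof.
apply: (cone_le_anti coneC).
  apply: vpos_le; last exact: le_vpos.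
  by rewrite /cone_le opprK subrK; exact: vpos_ge0.
have : pos x ⪯ pos (- x) + x.
  apply: vpos_le; first by rewrite /cone_le addrK; exact: vpos_ge0.
  by have := le_vpos (- x); rewrite /cone_le opprK.
by rewrite /cone_le; congr C; abel.
Qed.

Lemma vposZ a x : 0 <= a -> pos (a *: x) = a *: pos x.
Proof.
rewrite le_eqVlt => /predU1P[<-|a0].
  by rewrite !scale0r vpos_id//; exact: cone0.
have aZ b y : 0 < b -> pos (b *: y) ⪯ b *: pos y.
  move=> b0; apply: vpos_le; first by apply: cone_leZ (ltW _) (le_vpos _).
  by apply: coneZ (ltW _) (vpos_ge0 _).
apply: (cone_le_anti coneC); first exact: aZ.
have aV0 : 0 < a^-1 by rewrite invr_gt0.
have := cone_leZ coneC (ltW a0) (aZ _ (a *: x) aV0).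
by rewrite !scalerA divff ?gt_eqF// mulVf ?gt_eqF// !scale1r.
Qed.

Lemma vsupE x y : vsup C x y = y + pos (x - y).
Proof.
apply: (cone_le_anti coneC).
  apply: vsup_le; last exact/cone_le_add/vpos_ge0.
  by have := le_vpos (x - y); rewrite /cone_le; congr C; abel.
have : pos (x - y) ⪯ vsup C x y - y.
  apply: vpos_le; last exact: le_vsupr.
  by have := le_vsupl x y; rewrite /cone_le; congr C; abel.
by rewrite /cone_le; congr C; abel.
Qed.

Lemma le_vabs x : x ⪯ abs x. Proof. exact: le_vsupl. Qed.

Lemma leN_vabs x : - x ⪯ abs x. Proof. exact: le_vsupr. Qed.

Lemma vabs_le x u : x ⪯ u -> - x ⪯ u -> abs x ⪯ u.
Proof. exact: vsup_le. Qed.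

Lemma vabsE x : abs x = pos x + pos (- x).
Proof.
have two0 : 0 < 2 :> R by [].
rewrite /vabs vsupE opprK -mulr2n -scaler_nat vposZ ?ltW// vposN.
by rewrite scaler_nat mulr2n; abel.
Qed.

Lemma vabs_ge0 x : C (abs x).
Proof. by rewrite vabsE; apply: coneD => //; exact: vpos_ge0. Qed.

Lemma vabs_id x : C x -> abs x = x.
Proof. by move=> Cx; rewrite vabsE vposN vpos_id// subrr addr0. Qed.

Lemma vabsN x : abs (- x) = abs x.
Proof. by rewrite !vabsE opprK addrC. Qed.

Lemma vabsvabs x : abs (abs x) = abs x.
Proof. exact/vabs_id/vabs_ge0. Qed.

Lemma vabsD x y : abs (x + y) ⪯ abs x + abs y.
Proof.
apply: vabs_le; first by apply: cone_leD => //; exact: le_vabs.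
by rewrite opprD; apply: cone_leD => //; exact: leN_vabs.
Qed.

Lemma vabsZ a x : abs (a *: x) = `|a| *: abs x.
Proof.
wlog a0 : a x / 0 <= a => [th|].
  have [/th->//|a0] := leP 0 a.
  rewrite -[a *: x]opprK -scaleNr -scalerN th ?vabsN ?normrN//.
  by rewrite oppr_ge0 ltW.
by rewrite !vabsE -scalerN !vposZ// ger0_norm// scalerDr.
Qed.

Lemma vabs_eq0 x : abs x = 0 -> x = 0.
Proof.
move=> x0; apply: (cone_anti coneC).
  by have := leN_vabs x; rewrite x0 /cone_le opprK add0r.
by have := le_vabs x; rewrite x0 /cone_le add0r.
Qed.

Lemma vpos_le_vabs x : pos x ⪯ abs x.
Proof. by rewrite vabsE; apply: cone_le_add; exact: vpos_ge0. Qed.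

Lemma vposB x y : pos x - pos y ⪯ abs (x - y).
Proof.
apply: cone_le_subr; apply: vpos_le.
  have := cone_leD coneC (le_vabs (x - y)) (le_vpos y).
  by rewrite /cone_le; congr C; abel.
by apply: coneD => //; [exact: vabs_ge0|exact: vpos_ge0].
Qed.

Lemma vabs_vposB x y : abs (pos x - pos y) ⪯ abs (x - y).
Proof.
apply: vabs_le; first exact: vposB.
by rewrite opprB -[abs _]vabsN opprB; exact: vposB.
Qed.

Lemma vinf_lel x y : vinf C x y ⪯ x.
Proof. by rewrite /cone_le /vinf opprB addrC subrK; exact: vpos_ge0. Qed.

Lemma vinf_ler x y : vinf C x y ⪯ y.
Proof. by have := le_vpos (x - y); rewrite /cone_le /vinf; congr C; abel. Qed.

Lemma le_vinf x y u : u ⪯ x -> u ⪯ y -> u ⪯ vinf C x y.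
Proof.
move=> ux uy; have : pos (x - y) ⪯ x - u.
  by apply: vpos_le => //; apply: cone_leB => //; exact: cone_lexx.
by rewrite /cone_le /vinf; congr C; abel.
Qed.

Lemma vinfC x y : vinf C x y = vinf C y x.
Proof.
by apply: (cone_le_anti coneC); apply: le_vinf;
  do ?[exact: vinf_lel|exact: vinf_ler].
Qed.

Lemma vinf_ge0 x y : C x -> C y -> C (vinf C x y).
Proof. by move=> Cx Cy; apply/cone_le0/le_vinf; exact: cone_ge0. Qed.

Lemma vinf_idl x y : x ⪯ y -> vinf C x y = x.
Proof.
move=> xy; apply: (cone_le_anti coneC); first exact: vinf_lel.
by apply: le_vinf => //; exact: cone_lexx.
Qed.

(* The defect of subadditivity of the positive part detects opposite signs. *)
Lemma vposD_defect x y :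
  vinf C (pos x) (pos (- y)) ⪯ pos x + pos y - pos (x + y).
Proof.
set m := vinf _ _ _; have mx : m ⪯ pos x by exact: vinf_lel.
have my : m ⪯ pos (- y) by exact: vinf_ler.
have : pos (x + y) ⪯ pos x + pos y - m.
  apply: vpos_le; last first.
    by have := coneD coneC mx (vpos_ge0 y); congr C; abel.
  have := coneD coneC (le_vpos x) my.
  by rewrite vposN; congr C; abel.
by rewrite /cone_le; congr C; abel.
Qed.

(* If [v] exceeds [w] by more than the mesh [d], then some multiple of [d] lies
   strictly between them. *)
Lemma le_vinf_knots d v w n : C d -> C v -> C w -> v ⪯ d *+ n ->
  v - w ⪯ d + \sum_(i < n)
    vinf C (pos (v - d *+ i.+1)) (pos (d *+ i.+1 - w)).
Proof.
move=> Cd Cv Cw vn; pose g k := vinf C (pos (v - d *+ k)) (pos (d *+ k - w)).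
pose vk k := vinf C v (d *+ k); pose wk k := vinf C w (d *+ k).
(* [v] is truncated one knot higher than [w]: the induction then starts from a truncation of [v] at
   [d], and every further knot costs a single gap term. *)
have mesh k : vk k.+1 - wk k ⪯ d + \sum_(i < k) g i.+1.
  elim: k => [|k IHk].
    rewrite big_ord0 addr0 /wk mulr0n (_ : vinf C w 0 = 0) ?subr0.
      by rewrite /vk mulr1n; exact: vinf_ler.
    by rewrite vinfC vinf_idl//; exact: cone_ge0.
  (* The increment of the truncated [v] minus that of [w] is bounded in two ways. Dropping the
     increment of [w] leaves at most [pos (v - d *+ k.+1)]; bounding the increment of [v] by [d]
     leaves at most [pos (d *+ k.+1 - w)]. *)
  suff: vk k.+2 - vk k.+1 - (wk k.+1 - wk k) ⪯ g k.+1.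
    rewrite big_ord_recr/= => gk; have := coneD coneC IHk gk.
    by rewrite /cone_le; congr C; set S := \sum_(_ < _) _; abel.
  apply: le_vinf.
    have wkk : wk k ⪯ wk k.+1.
      apply: le_vinf; first exact: vinf_lel.
      apply: (le_trans (vinf_ler _ _)).
      by rewrite mulrSr; exact: cone_le_add.
    have vkv : vk k.+2 ⪯ v by exact: vinf_lel.
    have -> : vk k.+1 = v - pos (v - d *+ k.+1) by [].
    have := coneD coneC vkv wkk.
    by rewrite /cone_le; congr C; set y := pos _; abel.
  have vkd : vk k.+2 - d ⪯ vk k.+1.
    apply: le_vinf.
      apply: le_trans (vinf_lel v (d *+ k.+2)).
      by rewrite /cone_le opprB addrC subrK.
    by apply: cone_le_subr; rewrite -mulrSr; exact: vinf_ler.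
  have wkd : wk k ⪯ d *+ k by exact: vinf_ler.
  have -> : wk k.+1 = d *+ k.+1 - pos (d *+ k.+1 - w) by rewrite /wk vinfC.
  have := coneD coneC vkd wkd; rewrite /cone_le.
  by set y := pos _; rewrite mulrSr; set t := d *+ k; congr C; abel.
(* At the last knot the truncation of [v] is [v] itself, and that of [w] is at most [w]. *)
apply: le_trans (mesh n); apply: (cone_leB coneC); last exact: vinf_lel.
rewrite /vk vinf_idl; first exact: cone_lexx.
by rewrite mulrSr; apply: (le_trans vn); exact: cone_le_add.
Qed.

End VectorLatticeTheory.

(** * Banach lattices *)

(** The values of [v] inherit the Cauchy property from those of [u], and [W] is complete. As no map
    between the spaces is involved, this serves both to lift convergence back along [E] and to
    extend operators from the range of [j]. *)
Lemma cvg_of_dominated {R : realType} {V : normedModType R}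
    {W : completeNormedModType R} T (F : set_system T) {FF : ProperFilter F}
    (u : T -> V) (v : T -> W) (c : R) :
  0 < c -> (forall s t, `|v s - v t| <= c * `|u s - u t|) ->
  cvg (u @ F) -> cvg (v @ F).
Proof.
move=> c0 vu /cvg_ex[/= l ul].
apply/cauchy_cvgP/cauchy_exP => e e0.
have ec0 : 0 < e / c / 2 by rewrite !divr_gt0.
have near_l : \forall i \near F, `|l - u i| < e / c / 2 by exact: cvgr_dist_lt.
have [k lk] := filter_ex near_l.
exists (v k); suff: \forall i \near F, ball (v k) e (v i) by [].
near=> i; rewrite -ball_normE /=.
rewrite (le_lt_trans (vu _ _))// -ltr_pdivlMl// [c^-1 * e]mulrC.
have li : `|l - u i| < e / c / 2 by near: i.
rewrite (splitr (e / c)) (le_lt_trans _ (ltrD lk li))//.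
by rewrite [`|l - u k|]distrC (le_trans _ (ler_normD _ _))// addrA subrK.
Unshelve. all: by end_near. Qed.

Lemma tails_proper I (le : I -> I -> Prop) : directed le -> ProperFilter (tails le).
Proof.
move=> [[i _] lexx le_trans ledir].
apply: filter_from_proper => [|k _]; last by exists k; exact: lexx.
apply: filter_from_filter => [|k m _ _]; first by exists i.
by have [n [kn mn]] := ledir k m; exists n => // p np; split; exact: le_trans np.
Qed.

(** * Limits in closed cones *)

Section ClosedCone.
Context {R : realType} {E : normedModType R} {C : set E}.
Hypothesis closedC : closed C.

Lemma cone_lim T {F : set_system T} {FF : ProperFilter F} (u : T -> E) l :
  (\forall i \near F, C (u i)) -> u @ F --> l -> C l.
Proof. by move=> Cu; apply: closed_cvg. Qed.

Lemma cone_le_lim T {F : set_system T} {FF : ProperFilter F} (u v : T -> E) k l :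
  (\forall i \near F, cone_le C (u i) (v i)) -> u @ F --> k -> v @ F --> l ->
  cone_le C k l.
Proof.
by move=> uv uk vl; apply: (cone_lim (u := fun i => v i - u i) uv); exact: cvgB.
Qed.

Lemma cone_lim_le T {F : set_system T} {FF : ProperFilter F} (u : T -> E) l x :
  (\forall i \near F, cone_le C (u i) x) -> u @ F --> l -> cone_le C l x.
Proof. by move=> ux ul; apply: (cone_le_lim ux ul); exact: cvg_cst. Qed.

Lemma cone_le_lim_cst T {F : set_system T} {FF : ProperFilter F} (u : T -> E) l x :
  (\forall i \near F, cone_le C x (u i)) -> u @ F --> l -> cone_le C x l.
Proof. by move=> xu ul; apply: (cone_le_lim xu _ ul); exact: cvg_cst. Qed.

Lemma increasing_net_le_lim I (le : I -> I -> Prop) (u : I -> E) l i :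
  directed le -> increasing_net le C u -> u @ tails le --> l ->
  cone_le C (u i) l.
Proof.
move=> dir_le incu ul; have tailsF := tails_proper dir_le.
by apply: (cone_le_lim_cst _ ul); exists i => // k ik; exact: incu.
Qed.

End ClosedCone.

Section BanachLatticeTheory.
Context {R : realType} {X : completeNormedModType R} {Xp : set X}.
Hypothesis blX : banach_lattice Xp.

Local Notation "x ⪯ y" := (cone_le Xp x y) (at level 70).
Local Notation pos := (vpos Xp).
Local Notation abs := (vabs Xp).

Lemma bl_lattice : vector_lattice Xp. Proof. by case: blX. Qed.
Lemma bl_cone : is_cone Xp. Proof. by case: bl_lattice. Qed.
Lemma bl_closed : closed Xp. Proof. by case: blX => -[]. Qed.

Let latX := bl_lattice.
Let coneX := bl_cone.
Let closedX := bl_closed.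

Lemma norm_le_vabs x y : abs x ⪯ abs y -> `|x| <= `|y|.
Proof. by case: blX => _ _; exact. Qed.

Lemma norm_cone_le x y : Xp x -> x ⪯ y -> `|x| <= `|y|.
Proof.
move=> Xpx xy; apply: norm_le_vabs; rewrite !vabs_id//.
by apply: (cone_le0 (cone_le_trans coneX _ xy)); exact: cone_ge0.
Qed.

Lemma norm_vabs x : `|abs x| = `|x|.
Proof.
by apply/eqP; rewrite eq_le; apply/andP; split; apply: norm_le_vabs;
  rewrite vabsvabs//; exact: cone_lexx.
Qed.

Lemma norm_le_of_vabs x y : abs x ⪯ y -> `|x| <= `|y|.
Proof.
move=> xy; rewrite -norm_vabs; apply: norm_cone_le => //; exact: vabs_ge0.
Qed.

Lemma norm_vposB x y : `|pos x - pos y| <= `|x - y|.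
Proof. by rewrite -[leRHS]norm_vabs; apply/norm_le_of_vabs/vabs_vposB. Qed.

Lemma cvg_vpos T {F : set_system T} {FF : Filter F} (u : T -> X) l :
  u @ F --> l -> pos (u i) @[i --> F] --> pos l.
Proof.
move=> ul; apply/cvgrPdist_lt => e e0.
near=> i; apply: (le_lt_trans (norm_vposB _ _)); near: i.
exact: cvgr_dist_lt.
Unshelve. all: by end_near. Qed.

Lemma cvg_vabs T {F : set_system T} {FF : Filter F} (u : T -> X) l :
  u @ F --> l -> abs (u i) @[i --> F] --> abs l.
Proof.
move=> ul; rewrite (_ : (fun i => _) = fun i => pos (u i) + pos (- u i)).
  by rewrite vabsE//; apply: cvgD; apply: cvg_vpos => //; exact: cvgN.
by apply/funext => i; rewrite vabsE.
Qed.

(** * Consequences of order continuity of the norm *)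

Section OrderContinuous.
Hypothesis ocX : order_continuous_norm Xp.

Lemma directed_leq : directed (fun i k : nat => (i <= k)%N).
Proof.
split=> [|//|i k l|i k]; [by exists 0%N|exact: leq_trans|].
by exists (maxn i k); rewrite leq_maxl leq_maxr.
Qed.

Lemma increasing_net_nat (u : nat -> X) : (forall n, u n ⪯ u n.+1) ->
  increasing_net (fun i k : nat => (i <= k)%N) Xp u.
Proof.
move=> incu i k /subnK <-; elim: (k - i)%N => [|n IHn]; first exact: cone_lexx.
exact: (cone_le_trans coneX IHn).
Qed.

Lemma monotone_bounded_cvg (u : nat -> X) b : (forall n, u n ⪯ u n.+1) ->
  (forall n, Xp (u n)) -> (forall n, u n ⪯ b) ->
  exists2 l, u @ \oo --> l & forall n, u n ⪯ l.
Proof.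
move=> incu u0 ub; have inc := increasing_net_nat incu.
have /cvg_ex[/= l ul] : cvg (u @ \oo).
  apply: (ocX directed_leq inc u0).
  by exists 0, b => i; split=> //; exact: cone_ge0.
exists l => // n; exact: (increasing_net_le_lim closedX n directed_leq inc ul).
Qed.

(** The running suprema [s n] of [a] increase below [b], hence converge to some [l]. Summing the
    errors gives [s n ⪯ a m + t n m], so [l - a m] lies between [0] and [l - s n + t n m]; first [n]
    is fixed, then [m] grows. *)
Lemma almost_increasing_cvg (a : nat -> X) (e : nat -> nat -> X) b :
  (forall n, Xp (a n)) -> (forall n, a n ⪯ b) ->
  (forall n m, a n ⪯ a m + e n m) ->
  (forall n, e n m @[m --> \oo] --> 0) -> cvg (a @ \oo).
Proof.
move=> a0 ab ae e0.
pose s := fix s n := if n is n'.+1 then vsup Xp (s n') (a n) else a 0%N.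
have s0 n : Xp (s n).
  elim: n => [|n IHn]; first exact: a0.
  apply: cone_le0; apply: (cone_le_trans coneX (cone_ge0 IHn)).
  exact: (le_vsupl latX).
have incs n : s n ⪯ s n.+1 by exact: (le_vsupl latX).
have sb n : s n ⪯ b by elim: n => [|n IHn]; [exact: ab|exact: (vsup_le latX)].
have as_ n : a n ⪯ s n by case: n => [|n]; [exact: cone_lexx|exact: (le_vsupr latX)].
have [l sl s_le] := monotone_bounded_cvg incs s0 sb.
pose t n m := \sum_(i < n.+1) abs (e i m).
have tS n m : t n.+1 m = t n m + abs (e n.+1 m) by rewrite /t big_ord_recr.
have abs_e0 n : abs (e n m) @[m --> \oo] --> 0.
  have <- : abs 0 = 0 by rewrite vabs_id//; exact: cone0.
  exact: cvg_vabs.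
have t0 n : t n m @[m --> \oo] --> 0.
  elim: n => [|n IHn]; first by under eq_fun do rewrite /t big_ord1; exact: abs_e0.
  by under eq_fun do rewrite tS; rewrite -[0]addr0; exact: cvgD.
have t_ge0 n m : Xp (t n m).
  rewrite /t; elim/big_ind : _ => //; first exact: cone0.
  - by move=> x y; exact: coneD.
  - by move=> i _; exact: vabs_ge0.
have at_ n m : a n ⪯ a m + abs (e n m).
  apply: (cone_le_trans coneX (ae n m)); apply: cone_leD => //.
    exact: cone_lexx.
  exact: le_vabs.
have st n m : s n ⪯ a m + t n m.
  elim: n => [|n IHn]; first by rewrite /t big_ord1; exact: at_.
  apply: (vsup_le latX) => //.
    apply: (cone_le_trans coneX IHn); rewrite tS addrA.
    by apply: cone_le_add; exact: vabs_ge0.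
  apply: (cone_le_trans coneX (at_ n.+1 m)); rewrite tS.
  apply: (cone_leD coneX); first exact: cone_lexx.
  by rewrite addrC; exact: cone_le_add.
apply/cvg_ex; exists l; apply/cvgrPdist_lt => eps eps0.
have eps20 : 0 < eps / 2 by rewrite divr_gt0.
have /cvgrPdist_lt/(_ _ eps20)[n _ /(_ n (leqnn n)) /= sln] := sl.
near=> m.
have tm : `|0 - t n m| < eps / 2 by near: m; exact: cvgr_dist_lt.
have alm : a m ⪯ l by exact: (cone_le_trans coneX (as_ m) (s_le m)).
apply: le_lt_trans (_ : `|l - s n + t n m| < eps); last first.
  rewrite (splitr eps) (le_lt_trans (ler_normD _ _))// ltrD//.
  by rewrite sub0r normrN in tm.
apply: norm_cone_le => //.
by have := st n m; rewrite /cone_le; congr Xp; abel.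
Unshelve. all: by end_near. Qed.

(* On an order interval the norm topology is the one of [g |-> `|r |g||]. *)
Lemma dominated_small (r : {linear X -> X}) x : continuous r ->
  (forall y, Xp y -> Xp (r y)) -> (forall y, Xp y -> r y = 0 -> y = 0) ->
  Xp x -> forall eps, 0 < eps -> exists2 delta, 0 < delta &
    forall g, Xp g -> g ⪯ x -> `|r g| < delta -> `|g| < eps.
Proof.
move=> r_cont r_pos r_inj x0 eps eps0; apply: contrapT => no_delta.
pose q (k : nat) : R := 2^-1 ^+ k.
have q0 k : 0 < q k by rewrite exprn_gt0 ?invr_gt0.
have /choice[g gP] k : exists g, [/\ Xp g, g ⪯ x, `|r g| < q k & eps <= `|g|].
  apply: contrapT => no_g; apply: no_delta; exists (q k) => // g g0 gx rg.
  rewrite ltNge; apply/negP => eps_g; apply: no_g; exists g; split=> //.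
have g0 k : Xp (g k) by case: (gP k).
have gx k : g k ⪯ x by case: (gP k).
have rg k : `|r (g k)| < q k by case: (gP k).
(* [s n k] is the supremum of [g k, ..., g (k + n)], and its limit [S k] is that of the whole tail.
   The [S k] decrease to a vector killed by [r], hence to zero, although each dominates a [g k] of
   norm at least [eps]. *)
pose s := fix s n k := if n is n'.+1 then vsup Xp (g k) (s n' k.+1) else g k.
have gs n k : g k ⪯ s n k by case: n => [|n]; [exact: cone_lexx|exact: (le_vsupl latX)].
have s0 n k : Xp (s n k).
  by apply: cone_le0; apply: (cone_le_trans coneX (cone_ge0 (g0 k))); exact: gs.
have sx n k : s n k ⪯ x.
  by elim: n k => [|n IHn] k; [exact: gx|exact: (vsup_le latX)].
have s_inc k n : s n k ⪯ s n.+1 k.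
  elim: n k => [|n IHn] k; first exact: gs.
  apply: (vsup_le latX); first exact: gs.
  exact: (cone_le_trans coneX (IHn k.+1) (le_vsupr latX _ _)).
(* A supremum of positive vectors is at most their sum, so the geometric bounds on the [r (g i)]
   with [i >= k] add up to at most [2 * q k]. *)
have rs n k : `|r (s n k)| <= 2 * q k.
  elim: n k => [|n IHn] k /=.
    by rewrite (le_trans (ltW (rg k)))// ler_peMl ?ltW// ltr1n.
  have : vsup Xp (g k) (s n k.+1) ⪯ g k + s n k.+1.
    by apply: (vsup_le latX) => //; [|rewrite addrC]; exact: cone_le_add.
  move=> /r_pos; rewrite linearB linearD/= => rle.
  have /le_trans : `|r (s n.+1 k)| <= `|r (g k) + r (s n k.+1)|.
    by apply: norm_cone_le => //; exact: r_pos.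
  apply; rewrite (le_trans (ler_normD _ _))// [leRHS]mulr_natl mulr2n.
  rewrite lerD//; first exact: ltW.
  by rewrite (le_trans (IHn _))// /q exprS mulrA divff// mul1r.
have /choice[S SP] k : exists l, s n k @[n --> \oo] --> l /\ forall n, s n k ⪯ l.
  have [l sl le_l] := monotone_bounded_cvg (s_inc k) (s0^~ k) (sx^~ k).
  by exists l.
have Slim k := (SP k).1.
have s_le n k : s n k ⪯ S k by exact: (SP k).2.
have Sx k : S k ⪯ x.
  by apply: (cone_lim_le closedX _ (Slim k)); exact: nearW.
have S_dec k : S k.+1 ⪯ S k.
  apply: (cone_lim_le closedX _ (Slim k.+1)); apply: nearW => n.
  exact: (cone_le_trans coneX (le_vsupr latX _ _) (s_le n.+1 k)).
have S0 k : Xp (S k).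
  by apply: cone_le0; exact: (cone_le_trans coneX (cone_ge0 (s0 0%N k)) (s_le _ _)).
have rS k : `|r (S k)| <= 2 * q k.
  have : `|r (s n k)| @[n --> \oo] --> `|r (S k)|.
    apply: cvg_norm; exact: (continuous_cvg _ (r_cont _) (Slim k)).
  by move/cvgr_to_le; apply; exact: nearW.
(* The decreasing sequence [S] is handled through the increasing sequence [x - S k]. *)
have [l xSl _] : exists2 l, x - S k @[k --> \oo] --> l & forall k, x - S k ⪯ l.
  apply: (@monotone_bounded_cvg _ x) => k.
  - by apply: cone_leB => //; exact: cone_lexx.
  - exact: Sx.
  - by rewrite /cone_le opprB addrC subrK.
have {}xSl : S @ \oo --> x - l.
  rewrite (_ : S = fun k => x - (x - S k)); last first.
    by apply/funext => k; rewrite opprB addrC subrK.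
  by apply: cvgB => //; exact: cvg_cst.
have q_cvg : q k @[k --> \oo] --> 0.
  by apply: cvg_expr; rewrite ger0_norm ?invr_ge0// invf_lt1// ltr1n.
have rS0 : r (S k) @[k --> \oo] --> 0.
  apply/norm_cvg0P; apply: squeeze_cvgr (cvg_cst 0) _; last first.
    by rewrite -(mulr0 2); apply: cvgMr q_cvg; exact: cvg_cst.
  by apply: nearW => k; rewrite normr_ge0 rS.
have rl : r (x - l) = 0.
  apply: (cvg_unique _ _ rS0) => //; exact: (continuous_cvg _ (r_cont _) xSl).
have l0 : Xp (x - l) by apply: (cone_lim closedX _ xSl); exact: nearW.
have S_cvg0 : S @ \oo --> 0 by rewrite -(r_inj _ l0 rl).
have /cvgrPdist_lt/(_ _ eps0)[n _ /(_ n (leqnn n))/=] := S_cvg0.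
rewrite sub0r normrN ltNge => /negP; apply.
case: (gP n) => _ _ _ /le_trans; apply; apply: norm_cone_le => //.
exact: s_le 0%N n.
Qed.

End OrderContinuous.

End BanachLatticeTheory.

(** * Lattice structure of the extrapolation cone *)

Lemma continuous_linear_bound {R : realType} {V W : normedModType R}
    (f : {linear V -> W}) :
  continuous f -> exists2 K : R, 0 < K & forall x, `|f x| <= K * `|x|.
Proof.
move=> /linear_bounded_continuous/linear_boundedP fb.
near (pinfty_nbhs R) => K; exists K; last by near: K.
by near: K; exact: nbhs_pinfty_gt.
Unshelve. all: by end_near. Qed.

(* [E] stands for a resolvent operator and [P n] for [n] times the resolvent at
   a point of distance [n] to the right, all of them extended along [j]. *)
Record resolvent_approximation {R : realType} {X Z : completeNormedModType R}
    (Xp : set X) (j : {linear X -> Z}) (E : {linear Z -> X})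
    (P : nat -> {linear Z -> X}) : Prop := ResolventApproximation {
  ra_jcont : continuous j;
  ra_Econt : continuous E;
  ra_Pcont : forall n, continuous (P n);
  ra_below : exists2 c : R, 0 < c & forall z, `|z| <= c * `|E z|;
  ra_Epos : forall x, Xp x -> Xp (E (j x));
  ra_Ppos : forall n x, Xp x -> Xp (P n (j x));
  ra_id : forall x, P n (j x) @[n --> \oo] --> x;
  ra_EP : forall n z, E (j (P n z)) = P n (j (E z));
  ra_PP : forall n m z, P n (j (P m z)) = P m (j (P n z));
  ra_le : forall n x, Xp x -> Xp (E (j x) - E (j (P n (j x))))
}.

(** * Transfer of order and convergence between [Z] and [X] *)

Section Approximation.
Context {R : realType} {X Z : completeNormedModType R} {Xp : set X}
  {j : {linear X -> Z}} {E : {linear Z -> X}} {P : nat -> {linear Z -> X}}.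
Hypothesis blX : banach_lattice Xp.
Hypothesis ra : resolvent_approximation Xp j E P.

Let C : set Z := closure (j @` Xp).
Let latX := bl_lattice blX.
Let coneX := bl_cone blX.
Let closedX := bl_closed blX.

Local Notation "x ⪯ y" := (cone_le Xp x y) (at level 70).
Local Notation "x ≦ y" := (cone_le C x y) (at level 70).
Local Notation pos := (vpos Xp).
Local Notation abs := (vabs Xp).

Lemma ra_closed : closed C. Proof. exact: closed_closure. Qed.

Lemma ra_image x : Xp x -> C (j x).
Proof. by move=> Xpx; apply: subset_closure; exists x. Qed.

(** The preimage of [Xp] under [f] is closed, so positivity passes from the image of [Xp] to its
    closure. *)
Lemma ra_transfer (f : Z -> X) : continuous f ->
  (forall x, Xp x -> Xp (f (j x))) -> forall z, C z -> Xp (f z).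
Proof.
move=> f_cont fj; rewrite /C closureE; apply: smallest_sub => [|_ [x Xpx <-]].
  exact: closed_comp.
exact: fj.
Qed.

Lemma ra_EC z : C z -> Xp (E z).
Proof. by apply: ra_transfer; [exact: ra_Econt ra|exact: (ra_Epos ra)]. Qed.

Lemma ra_PC n z : C z -> Xp (P n z).
Proof. by apply: ra_transfer; [exact: (ra_Pcont ra)|exact: (ra_Ppos ra)]. Qed.

Lemma ra_Ej_cont : continuous (E \o j).
Proof.
by move=> x; apply: continuous_comp; [exact: (ra_jcont ra)|exact: (ra_Econt ra)].
Qed.

Lemma ra_Ej_cvg T (F : set_system T) {FF : Filter F} (u : T -> X) x :
  u @ F --> x -> E (j (u i)) @[i --> F] --> E (j x).
Proof.
by move=> ux; apply: (continuous_cvg (h := E \o j) _ _ ux); exact: ra_Ej_cont.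
Qed.

Lemma ra_EPC n z : C z -> E (j (P n z)) ⪯ E z.
Proof.
move=> Cz; rewrite /cone_le.
apply: (ra_transfer (f := fun z => E z - E (j (P n z)))) Cz => [|x Xpx];
  last exact: (ra_le ra).
move=> z'; apply: cvgB; first exact: (ra_Econt ra).
apply: (@continuous_comp _ _ _ (P n) (E \o j)); first exact: (ra_Pcont ra).
exact: ra_Ej_cont.
Qed.

Lemma ra_E_homo z w : z ≦ w -> E z ⪯ E w.
Proof. by rewrite /cone_le -linearB; exact: ra_EC. Qed.

Lemma ra_P_homo n z w : z ≦ w -> P n z ⪯ P n w.
Proof. by rewrite /cone_le -linearB; exact: ra_PC. Qed.

Lemma ra_Ej_homo x y : x ⪯ y -> E (j x) ⪯ E (j y).
Proof. by rewrite /cone_le -!linearB; exact: (ra_Epos ra). Qed.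

Lemma ra_Pj_homo n x y : x ⪯ y -> P n (j x) ⪯ P n (j y).
Proof. by rewrite /cone_le -!linearB; exact: (ra_Ppos ra). Qed.

Lemma ra_E_inj z : E z = 0 -> z = 0.
Proof.
have [c c0 zE] := ra_below ra => Ez; apply/normr0_eq0/eqP.
by rewrite eq_le normr_ge0 andbT (le_trans (zE z))// Ez normr0 mulr0.
Qed.

Lemma ra_E_cvg T (F : set_system T) {FF : Filter F} (u : T -> Z) z :
  E (u i) @[i --> F] --> E z -> u @ F --> z.
Proof.
have [c c0 zE] := ra_below ra => Eu.
apply/cvgrPdist_lt => e e0; near=> i.
rewrite (le_lt_trans (zE _))// -ltr_pdivlMl// linearB; near: i.
by apply: cvgr_dist_lt => //; rewrite mulrC divr_gt0.
Unshelve. all: by end_near. Qed.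

Lemma ra_E_is_cvg T (F : set_system T) {FF : ProperFilter F} (u : T -> Z) :
  cvg (E (u i) @[i --> F]) -> cvg (u @ F).
Proof.
have [c c0 zE] := ra_below ra; apply: cvg_of_dominated c0 _ => s t.
by rewrite -linearB; exact: zE.
Qed.

(** [E] reflects convergence, and once it is commuted past [P n] the sequence becomes the
    approximation of the vector [E z] of [X]. *)
Lemma ra_jP_cvg z : j (P n z) @[n --> \oo] --> z.
Proof.
by apply: ra_E_cvg; under eq_fun do rewrite (ra_EP ra); exact: (ra_id ra).
Qed.

(** Positivity in [Z] is tested in [X]: the [P n] are positive, and conversely [z] is the limit of
    the [j (P n z)]. Order statements about [Z] thereby turn into statements about [X]. *)
Lemma ra_coneP z : C z <-> forall n, Xp (P n z).
Proof.
split=> [Cz n|PXp]; first exact: ra_PC.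
apply: (cone_lim ra_closed _ (@ra_jP_cvg z)); apply: nearW => n.
exact/ra_image.
Qed.

Lemma ra_leP z w : z ≦ w <-> forall n, P n z ⪯ P n w.
Proof.
rewrite /cone_le ra_coneP; split=> zw n; by have := zw n; rewrite linearB.
Qed.

(** The identity between [Xp] and the part of the extrapolation cone in [X], here a consequence of
    the convergence of [P n] on [X]. *)
Lemma ra_imageP x : C (j x) <-> Xp x.
Proof.
split=> [/ra_coneP PXp|]; last exact: ra_image.
by apply: (cone_lim closedX _ (@ra_id _ _ _ _ _ _ _ ra x)); exact: nearW.
Qed.

Lemma ra_is_cone : is_cone C.
Proof.
split.
- by exists (j 0); apply/ra_image/(cone0 coneX).
- move=> a b x y a0 b0 /ra_coneP Cx /ra_coneP Cy; apply/ra_coneP => n.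
  by rewrite linearD !linearZ/=; apply: (coneD coneX); exact: (coneZ coneX).
- apply/seteqP; split=> [w [Cw [z Cz zw]]|_ ->]; last first.
    have C0 : C 0 by rewrite -(linear0 j); exact/ra_image/(cone0 coneX).
    by split=> //; exists 0 => //; rewrite oppr0.
  have := ra_EC Cw; rewrite -zw linearN => /(cone_anti coneX (ra_EC Cz)) Ez.
  by rewrite (ra_E_inj Ez) oppr0.
Qed.

Let coneC := ra_is_cone.

(** * Positive parts in [Z] and the ideal property of [X] *)

Section Lattice.
Hypothesis ocX : order_continuous_norm Xp.

(* [E (j (pos (P n z)))] is increasing up to an error that vanishes as its
   second index grows. *)
Lemma ra_vpos_sup z y : C y -> z ≦ y ->
  exists2 u, is_sup C z 0 u & j (pos (P n z)) @[n --> \oo] --> u.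
Proof.
move=> Cy zy; pose u n := pos (P n z).
have uP w n : C w -> z ≦ w -> u n ⪯ P n w.
  by move=> Cw zw; apply: vpos_le => //; [exact: ra_P_homo|exact: ra_PC].
have : cvg (E (j (u n)) @[n --> \oo]).
  apply: (@almost_increasing_cvg _ _ _ blX ocX _
    (fun n m => E (j (abs (P n z - P m (j (P n z)))))) (E y)).
  - by move=> n; apply: (ra_Epos ra); exact: (vpos_ge0 latX).
  - move=> n; apply: (cone_le_trans coneX _ (ra_EPC n Cy)).
    exact/ra_Ej_homo/uP.
  - move=> n m; set e := abs _.
    have PuE : P m (j (P n z)) = P n (j (P m z)) by exact: (ra_PP ra _ _ _).
    (* Trading [P n z] for [P m (j (P n z))], which equals [P n (j (P m z))], costs the error [e].
       Positivity of [P n] then pulls it out of the positive part, and afterwards [E] absorbs it. *)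
    have : u n ⪯ P n (j (u m)) + e.
      have le_e : u n - pos (P n (j (P m z))) ⪯ e.
        by rewrite -PuE; exact: vposB.
      have : pos (P n (j (P m z))) ⪯ P n (j (u m)).
        apply: vpos_le => //; first exact/ra_Pj_homo/le_vpos.
        exact/(ra_Ppos ra)/vpos_ge0.
      by move: le_e => /(coneD coneX)/[apply]; rewrite /cone_le; congr Xp; abel.
    move=> /ra_Ej_homo/(cone_le_trans coneX); apply; rewrite !linearD/=.
    apply: cone_leD => //; last exact: cone_lexx.
    exact/ra_EPC/ra_image/vpos_ge0.
  - move=> n.
    have : P n z - P m (j (P n z)) @[m --> \oo] --> 0.
      by rewrite -(subrr (P n z)); apply: cvgB; [exact: cvg_cst|exact: (ra_id ra)].
    move/(cvg_vabs blX); rewrite vabs_id//; last exact: cone0.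
    by move/ra_Ej_cvg; rewrite !linear0.
move=> /(ra_E_is_cvg (u := j \o u))/cvg_ex[/= l ul].
exists l => //; split.
- apply: (cone_le_lim ra_closed _ (@ra_jP_cvg z) ul); apply: nearW => n.
  by rewrite /cone_le -linearB; apply: ra_image; exact: (le_vpos latX).
- rewrite /cone_le subr0; apply: (cone_lim ra_closed _ ul); apply: nearW => n.
  by apply: ra_image; exact: (vpos_ge0 latX).
(* Any competing upper bound [w] satisfies [u n ⪯ P n w], and both sides converge in [Z]. *)
- move=> w zw; rewrite /cone_le subr0 => Cw.
  apply: (cone_le_lim ra_closed _ ul (@ra_jP_cvg w)); apply: nearW => n.
  by rewrite /cone_le -linearB; apply: ra_image; exact: uP.
Qed.

(* The convexity of the positive part plays the role that is usually given to the
   weak compactness of order intervals. *)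
Lemma ra_gap z y : C y -> z ≦ y -> forall e : R, 0 < e -> exists N, forall n m,
  (N <= n)%N -> (N <= m)%N ->
  `|E (j (vinf Xp (pos (P n z)) (pos (- P m z))))| < e.
Proof.
move=> Cy zy e e0.
have [u [zu u0 _] u_cvg] := ra_vpos_sup Cy zy.
have Cu : C u by move: u0; rewrite /cone_le subr0.
have Eu_cvg : E (j (pos (P n z))) @[n --> \oo] --> E u.
  by apply: (continuous_cvg (h := E) _ _ u_cvg); exact: (ra_Econt ra).
have uP n : pos (P n z) ⪯ P n u.
  by apply: (vpos_le latX); [exact: ra_P_homo|exact: ra_PC].
have EuP n : E (j (pos (P n z))) ⪯ E u.
  exact: (cone_le_trans coneX (ra_Ej_homo (uP n)) (ra_EPC n Cu)).
have [K K0 EjK] := continuous_linear_bound (f := E \o j) ra_Ej_cont.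
have e40 : 0 < e / 4 by rewrite divr_gt0.
have near_u : \forall l \near \oo, `|E u - E (j (pos (P l z)))| < e / 4.
  exact: cvgr_dist_lt.
(* The index [l] is fixed first, close to the limit [E u]; [N] is chosen afterwards so that
   [P l (j (P n z))] is close to [P l z]. *)
have [l ul] := filter_ex near_u.
have eK0 : 0 < e / 4 / K by rewrite divr_gt0.
have : P l (j (P n z)) @[n --> \oo] --> P l z.
  by under eq_fun do rewrite (ra_PP ra); exact: (ra_id ra).
move=> /cvgrPdist_lt/(_ _ eK0)[N _ PN]; exists N => n m /PN /= Pn /PN /= Pm.
set g := vinf _ _ _; pose w := pos (P n z + P m z).
have g_le : g ⪯ pos (P n z) + pos (P m z) - w by exact: vposD_defect.
have g0 : Xp g by apply: (vinf_ge0 latX); exact: (vpos_ge0 latX).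
(* The subtracted term [E (j w)] is bounded below by [E (j t)], with [t] close to [p + p]. What
   remains is twice the distance of [E (j p)] from [E u], plus [E (j (p + p - t))]; each contributes
   less than half of [e]. *)
pose t := pos (P l (j (P n z + P m z))).
have tw : E (j t) ⪯ E (j w).
  apply: (cone_le_trans coneX (y := E (j (P l (j w))))); last first.
    exact/ra_EPC/ra_image/(vpos_ge0 latX).
  apply: ra_Ej_homo; apply: (vpos_le latX); first exact/ra_Pj_homo/(le_vpos latX).
  exact/(ra_Ppos ra)/(vpos_ge0 latX).
pose p := pos (P l z).
have Eg : E (j g) ⪯ (E u - E (j p)) + (E u - E (j p)) + E (j (p + p - t)).
  apply: (cone_le_trans coneX (ra_Ej_homo g_le)).
  have EjD x x' : E (j (x + x')) = E (j x) + E (j x') by rewrite !linearD.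
  have EjB x x' : E (j (x - x')) = E (j x) - E (j x') by rewrite !linearB.
  rewrite !EjB !EjD; have := coneD coneX (coneD coneX (EuP n) (EuP m)) tw.
  rewrite /cone_le; move: (E (j (pos (P n z)))) (E (j (pos (P m z)))) => a b.
  by move: (E (j w)) (E (j t)) (E (j p)) => c d f; congr Xp; abel.
have Ejg0 : Xp (E (j g)) by exact: (ra_Epos ra).
rewrite (le_lt_trans (norm_cone_le blX Ejg0 Eg))//.
have ppt : `|p + p - t| < e / 4 / K + e / 4 / K.
  have -> : p + p = pos (P l z + P l z).
    have := vposZ latX (P l z) (ler0n R 2).
    by rewrite !scaler_nat !mulr2n => ->.
  rewrite /t (le_lt_trans (norm_vposB blX _ _))// !linearD/= addrACA.
  by rewrite (le_lt_trans (ler_normD _ _))// ltrD.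
have Eppt : `|E (j (p + p - t))| < e / 4 + e / 4.
  rewrite (le_lt_trans (EjK _))// -ltr_pdivlMl// mulrDr.
  by rewrite ![K^-1 * _]mulrC.
rewrite (le_lt_trans (ler_normD _ _))//.
have -> : e = (e / 4 + e / 4) + (e / 4 + e / 4) by field.
by rewrite ltrD// (le_lt_trans (ler_normD _ _))// ltrD.
Qed.

Lemma norm_vinfB x y x' y' :
  `|vinf Xp x y - vinf Xp x' y'| <= 2 * `|x - x'| + `|y - y'|.
Proof.
have -> : vinf Xp x y - vinf Xp x' y' =
    (x - x') - (pos (x - y) - pos (x' - y')).
  by rewrite /vinf; set a := pos _; set b := pos _; abel.
rewrite (le_trans (ler_normB _ _))// [2 * _]mulr_natl mulr2n -addrA lerD2l.
rewrite (le_trans (norm_vposB blX _ _))//.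
have -> : x - y - (x' - y') = (x - x') - (y - y') by abel.
exact: ler_normB.
Qed.

(** The approximants [P n z] are truncated at [x] to lie in one order interval, where
    [dominated_small] turns smallness under [E] into smallness in norm. *)
Lemma ra_ideal z x : C z -> z ≦ j x -> exists y, z = j y.
Proof.
move=> Cz zx.
have Cjx : C (j x) by have := coneD coneC Cz zx; rewrite addrC subrK.
have Xpx : Xp x by exact/ra_imageP.
pose v n := vinf Xp (P n z) x.
have v0 n : Xp (v n) by apply: (vinf_ge0 latX) => //; exact: ra_PC.
have vx n : v n ⪯ x by exact: (vinf_ler latX).
have Pv n : P n z - v n = pos (P n z - x) by rewrite opprB addrC subrK.
(* The truncation removes [pos (P n z - x)], which is at most the modulus of [P n (j x) - x] because
   [z] lies below [j x]. *)
have Pv0 : P n z - v n @[n --> \oo] --> 0.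
  have : `|P n (j x) - x| @[n --> \oo] --> 0.
    rewrite -(normr0 X) -(subrr x); apply: cvg_norm; apply: cvgB.
      exact: (ra_id ra).
    exact: cvg_cst.
  move=> Px; apply/norm_cvg0P; apply: squeeze_cvgr (cvg_cst 0) Px.
  apply: nearW => n; rewrite normr_ge0 Pv/= -[leRHS](norm_vabs blX).
  apply: (norm_cone_le blX); first exact: (vpos_ge0 latX).
  apply: (vpos_le latX); last exact: (vabs_ge0 latX).
  apply: (cone_le_trans coneX _ (le_vabs latX _)).
  by apply: (cone_leB coneX); [exact: ra_P_homo|exact: (cone_lexx coneX)].
have [K K0 EjK] := continuous_linear_bound (f := E \o j) ra_Ej_cont.
have knot c : Xp c -> forall e : R, 0 < e -> exists N, forall n m,
    (N <= n)%N -> (N <= m)%N ->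
    `|vinf Xp (pos (v n - c)) (pos (c - v m))| < e.
  move=> Xpc e e0.
  have [delta delta0 small] : exists2 delta, 0 < delta & forall g, Xp g ->
      g ⪯ x -> `|(E \o j) g| < delta -> `|g| < e.
    apply: (dominated_small blX ocX ra_Ej_cont _ _ Xpx e0).
      exact: (ra_Epos ra).
    (* If [j y] vanishes, then [ra_imageP] makes [- y] positive along with [y]. *)
    move=> y Xpy /= /ra_E_inj jy; apply: (cone_anti coneX Xpy).
    by apply/ra_imageP; rewrite linearN jy oppr0; exact: (cone0 coneC).
  have d20 : 0 < delta / 2 by rewrite divr_gt0.
  have zcx : z - j c ≦ j x.
    apply: (cone_le_trans coneC _ zx).
    by rewrite /cone_le opprB addrC subrK; exact: ra_image.
  have [N1 gapN] := ra_gap Cjx zcx d20.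
  (* Replacing [v n - c] by [P n (z - j c)] in the infimum is charged twice in its first argument
     and once in its second: three errors of [delta / 6 / K]. *)
  have dK0 : 0 < delta / 6 / K by rewrite !divr_gt0.
  have : (v n - c) - P n (z - j c) @[n --> \oo] --> 0.
    rewrite (_ : (fun _ => _) = fun n => (P n (j c) - c) - (P n z - v n)).
      rewrite -[0]subr0 -{1}(subrr c); apply: cvgB => //; apply: cvgB.
        exact: (ra_id ra).
      exact: cvg_cst.
    apply/funext => n.
    have -> : P n (z - j c) = P n z - P n (j c) by exact: linearB.
    abel.
  move=> /cvgrPdist_lt/(_ _ dK0)[N2 _ vP].
  exists (maxn N1 N2) => n m; rewrite !geq_max => /andP[Nn1 Nn2] /andP[Nm1 Nm2].
  apply: small.
  - by apply: (vinf_ge0 latX); exact: (vpos_ge0 latX).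
  - apply: (cone_le_trans coneX (vinf_lel latX _ _)).
    apply: (vpos_le latX) => //; apply: (cone_le_trans coneX _ (vx n)).
    by rewrite /cone_le opprB addrC subrK.
  - have /(_ n m Nn1 Nm1) gap := gapN.
    have := vP _ Nn2; have := vP _ Nm2; rewrite /= !sub0r !normrN => vPm vPn.
    move: gap; set h := vinf _ (pos (P _ _)) _; set g := vinf _ _ _ => gap.
    have gh : `|g - h| < delta / 2 / K.
      rewrite (le_lt_trans (norm_vinfB _ _ _ _))//.
      have -> : delta / 2 / K = 2 * (delta / 6 / K) + delta / 6 / K.
        by field; rewrite gt_eqF.
      apply: ltrD.
        by rewrite ltr_pM2l// (le_lt_trans (norm_vposB blX _ _)).
      rewrite (le_lt_trans (norm_vposB blX _ _))//.
      by move: vPm; rewrite -normrN; congr (`|_| < _); abel.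
    have Egh : `|E (j (g - h))| < delta / 2.
      by rewrite (le_lt_trans (EjK _))// -ltr_pdivlMl// mulrC.
    rewrite [ltLHS](_ : _ = `|E (j (g - h)) + E (j h)|); last by rewrite -!linearD subrK.
    rewrite (splitr delta).
    by rewrite (le_lt_trans (ler_normD _ _))// ltrD.
have v_pos e : 0 < e -> exists N, forall n m, (N <= n)%N -> (N <= m)%N ->
    `|pos (v n - v m)| < e.
  move=> e0; have e20 : 0 < e / 2 by rewrite divr_gt0.
  (* The mesh [d] has norm below [e / 2], and the [k.+1] knots share the other half of [e]
     equally. *)
  have [k xk] : exists k : nat, `|x| / k.+1%:R < e / 2.
    exists (Num.bound (`|x| / (e / 2))).
    rewrite ltr_pdivrMr// -ltr_pdivrMl// mulrC.
    apply: (lt_trans (archi_boundP _)); first by rewrite divr_ge0// ltW.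
    by rewrite ltr_nat.
  pose d := k.+1%:R^-1 *: x.
  have dx : d *+ k.+1 = x.
    by rewrite -scaler_nat scalerA divff ?scale1r// pnatr_eq0.
  have Xpd : Xp d by apply: (coneZ coneX).
  have ek0 : 0 < e / 2 / k.+1%:R by rewrite divr_gt0.
  have /choice[N NP] (i : nat) := knot _ (coneMn coneX i.+1 Xpd) _ ek0.
  exists (\max_(i < k.+1) N i) => n m /bigmax_leqP Nn /bigmax_leqP Nm.
  have := @le_vinf_knots _ _ _ latX d (v n) (v m) k.+1 Xpd (v0 n) (v0 m).
  rewrite dx => /(_ (vx n)).
  set S := \sum_(i < _) _ => vv.
  have S0 : Xp (d + S).
    apply: (coneD coneX) => //; rewrite /S; elim/big_ind : _ => //.
    - exact: (cone0 coneX).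
    - by move=> a b; exact: (coneD coneX).
    - by move=> i _; apply: (vinf_ge0 latX); exact: (vpos_ge0 latX).
  have : pos (v n - v m) ⪯ d + S by exact: (vpos_le latX).
  move=> /(norm_cone_le blX (vpos_ge0 latX _))/le_lt_trans; apply.
  rewrite (splitr e) (le_lt_trans (ler_normD _ _))// ltr_leD//.
    by rewrite normrZ ger0_norm// mulrC.
  rewrite (le_trans (ler_norm_sum _ _ _))//.
  have -> : e / 2 = \sum_(i < k.+1) (e / 2 / k.+1%:R).
    by rewrite sumr_const card_ord -[RHS]mulr_natr divfK// pnatr_eq0.
  by apply: ler_sum => i _; apply/ltW/NP; [exact: Nn|exact: Nm].
have /cauchy_cvgP/cvg_ex[/= y vy] : cauchy (v @ \oo).
  apply/cauchy_exP => e e0; have e20 : 0 < e / 2 by rewrite divr_gt0.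
  have [N vN] := v_pos _ e20; exists (v N); exists N => // n /= Nn.
  rewrite -ball_normE /=.
  have -> : v N - v n = pos (v N - v n) - pos (v n - v N).
    have -> : pos (v n - v N) = pos (v N - v n) - (v N - v n).
      by have := vposN latX (v N - v n); rewrite opprB.
    by set p := pos _; abel.
  by rewrite (splitr e) (le_lt_trans (ler_normB _ _))// ltrD// vN.
exists y.
have Py : P n z @[n --> \oo] --> y.
  rewrite (_ : (fun _ => _) = fun n => v n + (P n z - v n)).
    by rewrite -[y]addr0; exact: cvgD.
  by apply/funext => n; rewrite addrC subrK.
apply: (cvg_unique _ (@ra_jP_cvg z)) => //.
by apply: (continuous_cvg (h := j) _ _ Py); exact: (ra_jcont ra).
Qed.

End Lattice.

End Approximation.
(** * The lattice norm on the span *)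

Lemma bounded_additive_continuous {R : realType} {V W : normedModType R}
    (f : V -> W) (c : R) :
  0 < c -> {morph f : x y / x - y} -> (forall x, `|f x| <= c * `|x|) ->
  continuous f.
Proof.
move=> c0 fB fc x; apply/cvgrPdist_lt => e e0; near=> y.
rewrite -fB (le_lt_trans (fc _))// -ltr_pdivlMl//.
near: y; apply: cvgr_dist_lt; last by rewrite mulrC divr_gt0.
exact: cvg_id.
Unshelve. all: by end_near. Qed.

Lemma half_expr_cvg0 {R : realType} : (2^-1 : R) ^+ n @[n --> \oo] --> 0.
Proof. by apply: cvg_expr; rewrite ger0_norm ?invr_ge0// invf_lt1// ltr1n. Qed.

(** A Cauchy filter contains balls of radius [2^-1 ^+ n]. Consecutive balls meet, which bounds the
    distance of their centres geometrically, and the filter follows the limit of the centres. *)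
Lemma cauchy_cvg_of_fast_sequences {R : realType} {V : normedModType R} :
  (forall x : nat -> V, (forall n, `|x n.+1 - x n| <= 2 * 2^-1 ^+ n) ->
     cvg (x @ \oo)) ->
  forall F : set_system V, ProperFilter F -> cauchy F -> cvg F.
Proof.
move=> fast F FF /cauchyP F_cauchy; pose q n : R := 2^-1 ^+ n.
have q0 n : 0 < q n by rewrite exprn_gt0 ?invr_gt0.
have /choice[x xF] n : exists x, F (ball x (q n)) by exact: F_cauchy.
have /cvg_ex[/= l xl] : cvg (x @ \oo).
  apply: fast => n.
  have [y [yn yn1]] := filter_ex (filterI (xF n) (xF n.+1)).
  have -> : x n.+1 - x n = (y - x n) - (y - x n.+1) by abel.
  move: yn yn1; rewrite -!ball_normE/= ![`|_ - y|]distrC => yn yn1.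
  rewrite (le_trans (ler_normB _ _))// mulr_natl mulr2n lerD ?ltW//.
  by rewrite (lt_le_trans yn1)// /q exprS ler_piMl ?ltW// invf_lt1// ltr1n.
apply/cvg_ex; exists l; apply/cvgrPdist_lt => e e0.
have e20 : 0 < e / 2 by rewrite divr_gt0.
have q_cvg : q n @[n --> \oo] --> 0 by exact: half_expr_cvg0.
near \oo => n; apply: (filterS _ (xF n)) => w; rewrite -ball_normE/= => xw.
have -> : l - w = (l - x n) + (x n - w) by rewrite addrA subrK.
rewrite (splitr e) (le_lt_trans (ler_normD _ _))// ltrD//.
  by near: n; exact: cvgr_dist_lt.
rewrite (lt_trans xw)// -[ltLHS]gtr0_norm// -normrN -sub0r.
by near: n; exact: cvgr_dist_lt.
Unshelve. all: by end_near. Qed.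

Lemma cvg_of_dist {R : realType} {V : normedModType R} T (F : set_system T)
    {FF : Filter F} (u : T -> V) l :
  `|l - u i| @[i --> F] --> 0 -> u @ F --> l.
Proof.
move=> ul; apply/cvgrPdist_lt => e e0.
have /cvgrPdist_lt/(_ _ e0) := ul; apply: filterS => i.
by rewrite sub0r normrN normr_id.
Qed.

Lemma cvg_series_geometric {R : realType} {V : completeNormedModType R}
    (u : nat -> V) (A : R) :
  (forall n, `|u n| <= A * 2^-1 ^+ n) -> cvgn (series u).
Proof.
move=> uA; apply: normed_cvg.
apply: (@series_le_cvg _ _ (geometric A 2^-1)).
- by move=> n; exact: normr_ge0.
- by move=> n; rewrite (le_trans _ (uA n)).
- exact: uA.
- by apply: is_cvg_geometric_series; rewrite ger0_norm ?invr_ge0// invf_lt1// ltr1n.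
Qed.

Section SpanLattice.
Context {R : realType} {X Z : completeNormedModType R} {Xp : set X}
  {j : {linear X -> Z}} {E : {linear Z -> X}} {P : nat -> {linear Z -> X}}.
Hypothesis blX : banach_lattice Xp.
Hypothesis ocX : order_continuous_norm Xp.
Hypothesis ra : resolvent_approximation Xp j E P.

Let C : set Z := closure (j @` Xp).
Let S : lmodType R := span_space C.
Let D : set S := span_cone C.
Let latX := bl_lattice blX.
Let coneX := bl_cone blX.
Let coneC : is_cone C := ra_is_cone blX ra.

Local Notation "x ⪯ y" := (cone_le Xp x y) (at level 70).
Local Notation "x ≦ y" := (cone_le C x y) (at level 70).
Local Notation "x ⊑ y" := (cone_le D x y) (at level 70).

Definition span_sub (z : Z) (Cz : C z) : S :=
  Sub z (mem_set (sub_smallest (@subset_refl _ C) Cz)).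

Lemma span_subK z (Cz : C z) : \val (span_sub Cz) = z.
Proof. exact: SubK. Qed.

Lemma span_coneE x : D x = C (\val x). Proof. by []. Qed.

Lemma span_val0 : \val (0 : S) = 0. Proof. by []. Qed.

Lemma span_valD (x y : S) : \val (x + y) = \val x + \val y. Proof. by []. Qed.

Lemma span_valN (x : S) : \val (- x) = - \val x. Proof. by []. Qed.

Lemma span_valZ a (x : S) : \val (a *: x) = a *: \val x. Proof. by []. Qed.

Lemma span_leE x y : (x ⊑ y) = (\val x ≦ \val y).
Proof. by rewrite /cone_le span_coneE span_valD span_valN. Qed.

Lemma span_decomp (x : S) : exists y z, [/\ C y, C z & \val x = y - z].
Proof.
have /set_mem : \val x \in lin_span C by exact: valP.
by move: (\val x) => z; rewrite lin_spanE.
Qed.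

Lemma span_is_cone : is_cone D.
Proof.
split.
- by exists 0; rewrite span_coneE span_val0; exact: cone0.
- move=> a b x y a0 b0; rewrite !span_coneE span_valD !span_valZ => Cx Cy.
  by apply: (coneD coneC); exact: (coneZ coneC).
- apply/seteqP; split=> [w [Cw [z Cz zw]]|_ ->].
    apply: val_inj; rewrite span_val0; apply: (cone_anti coneC); first exact: Cw.
    by rewrite -zw span_valN opprK.
  by split; [|exists 0; rewrite ?oppr0//]; rewrite span_coneE span_val0; exact: cone0.
Qed.

Lemma span_is_sup x y s :
  is_sup C (\val x) (\val y) (\val s) -> is_sup D x y s.
Proof.
move=> [xs ys smin]; split; rewrite ?span_leE// => u.
by rewrite !span_leE; exact: smin.
Qed.

Lemma span_lattice : vector_lattice D.
Proof.
apply: (vector_lattice_of_pos span_is_cone) => x.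
have [y [z [Cy Cz xyz]]] := span_decomp x.
have xy : \val x ≦ y by rewrite /cone_le xyz opprB addrC subrK.
have [u supu _] := ra_vpos_sup blX ra ocX Cy xy.
have Cu : C u by case: supu => _; rewrite /cone_le subr0.
by exists (span_sub Cu); apply: span_is_sup; rewrite span_subK span_val0.
Qed.

Let coneD_ := span_is_cone.
Let latD := span_lattice.

(** Taking the modulus before applying the positive operator [E] makes this norm monotone in the
    modulus. *)
Definition span_lattice_norm (x : S) : R := `|E (\val (vabs D x))|.
Local Notation N := span_lattice_norm.

Lemma span_E_homo x y : x ⊑ y -> E (\val x) ⪯ E (\val y).
Proof. by rewrite span_leE; exact: (ra_E_homo blX ra). Qed.

Lemma span_E_ge0 x : D x -> Xp (E (\val x)).
Proof. exact: (ra_EC blX ra). Qed.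

Lemma span_norm_homo x y : vabs D x ⊑ vabs D y -> N x <= N y.
Proof.
move=> xy; apply: (norm_cone_le blX); last exact: span_E_homo.
exact/span_E_ge0/(vabs_ge0 latD).
Qed.

Lemma span_norm_ge0E x : D x -> N x = `|E (\val x)|.
Proof. by move=> Dx; rewrite /N (vabs_id latD). Qed.

Lemma norm_E_le x : `|E (\val x)| <= N x.
Proof.
apply: (norm_le_of_vabs blX); apply: (vabs_le latX).
  exact/span_E_homo/(le_vabs latD).
by rewrite -linearN -span_valN; apply/span_E_homo/(leN_vabs latD).
Qed.

(** The modulus of [y - z] is at most [y + z], and [E] is positive. The bound serves both the
    equivalence of norms and completeness. *)
Lemma span_norm_le x y z : C y -> C z -> \val x = y - z ->
  N x <= `|E y| + `|E z|.
Proof.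
move=> Cy Cz xyz.
have xle : vabs D x ⊑ span_sub Cy + span_sub Cz.
  apply: (vabs_le latD); rewrite span_leE span_valD !span_subK ?span_valN xyz.
    by rewrite /cone_le; have := coneD coneC Cz Cz; congr C; abel.
  by rewrite /cone_le; have := coneD coneC Cy Cy; congr C; abel.
rewrite (le_trans _ (ler_normD _ _))// -linearD.
have := span_E_homo xle; rewrite span_valD !span_subK.
by apply: (norm_cone_le blX); exact/span_E_ge0/(vabs_ge0 latD).
Qed.

Lemma span_lattice_norm_is_norm : is_norm N.
Proof.
split.
- move=> x y; have := span_E_homo (vabsD latD x y); rewrite span_valD linearD => xy.
  rewrite (le_trans _ (ler_normD _ _))//; apply: (norm_cone_le blX) xy.
  exact/span_E_ge0/(vabs_ge0 latD).
- by move=> a x; rewrite /N (vabsZ latD) !linearZ/= normrZ normr_id.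
- move=> x /normr0_eq0 /(ra_E_inj ra) x0; apply: (vabs_eq0 latD).
  by apply: val_inj; rewrite x0 span_val0.
Qed.

(** One estimate takes the infimum in [span_norm_le]. The other uses the decomposition into positive
    and negative part, each of norm at most [c * N x] in [Z], whence the constant [c + c]. *)
Lemma span_lattice_norm_equivalent : equivalent_norms N (span_norm C).
Proof.
have [K K0 EK] := continuous_linear_bound (ra_Econt ra).
have [c c0 zE] := ra_below ra.
have lb0 x : lbound [set r | exists y z, [/\ C y, C z, \val x = y - z &
    r = `|y| + `|z|]] 0.
  by move=> _ [y [z [_ _ _ ->]]]; rewrite addr_ge0.
exists K, (c + c); split=> // [|x]; first by rewrite addr_gt0.
split.
  rewrite -ler_pdivrMl//; apply: lb_le_inf.
    have [y [z [Cy Cz xyz]]] := span_decomp x.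
    by exists (`|y| + `|z|), y, z.
  move=> _ [y [z [Cy Cz xyz ->]]]; rewrite ler_pdivrMl// mulrDr.
  by rewrite (le_trans (span_norm_le Cy Cz xyz))// lerD.
have Cp y : C (\val (vpos D y)) by exact: (vpos_ge0 latD).
have Np y : N (vpos D y) <= N y.
  apply: span_norm_homo; rewrite (vabs_id latD); last exact: (vpos_ge0 latD).
  exact: (vpos_le_vabs latD).
have Zp y : `|\val (vpos D y)| <= c * N y.
  rewrite (le_trans (zE _))// ler_pM2l// (le_trans _ (Np y))//.
  exact: norm_E_le.
apply: (le_trans (y := `|\val (vpos D x)| + `|\val (vpos D (- x))|)).
  apply: ge_inf; first by exists 0; exact: lb0.
  exists (\val (vpos D x)), (\val (vpos D (- x))); split=> //.
  by rewrite -span_valN -span_valD (vposN latD) opprB addrC subrK.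
rewrite mulrDl lerD// (le_trans (Zp _))// ler_pM2l// /N.
by rewrite (vabsN latD).
Qed.

Let W : normedModType R := renormed span_lattice_norm_is_norm.

Lemma renormed_normE (x : W) : `|x| = N x. Proof. by []. Qed.

Lemma val_norm_le : exists2 c : R, 0 < c & forall x : W, `|\val (x : S)| <= c * `|x|.
Proof.
have [c c0 zE] := ra_below ra; exists c => // x.
by rewrite (le_trans (zE _))// ler_pM2l// renormed_normE norm_E_le.
Qed.

Lemma val_continuous : continuous (fun x : W => \val (x : S)).
Proof.
by have [c c0 val_le] := val_norm_le; exact: bounded_additive_continuous c0 _ val_le.
Qed.

Lemma renormed_cone_closed : closed (D : set W).
Proof.
rewrite (_ : D = (fun x : W => \val (x : S)) @^-1` C)//.
apply: closed_comp (ra_closed (j := j) (Xp := Xp)).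
by move=> x _; exact: val_continuous.
Qed.

(** The positive and the negative parts of the increments form two series that converge absolutely
    in [Z], with remainders in the closed cone. *)
Lemma renormed_complete (F : set_system W) : ProperFilter F -> cauchy F -> cvg F.
Proof.
apply: cauchy_cvg_of_fast_sequences => x Nd'.
pose d n : S := (x n.+1 : S) - (x n : S).
have Nd n : N (d n) <= 2 * 2^-1 ^+ n by exact: Nd'.
have [c c0 val_le] := val_norm_le.
have series_cvg (f : S -> S) : (forall y, D (f y)) -> (forall y, N (f y) <= N y) ->
    exists2 l, series (\val \o f \o d) @ \oo --> l &
      forall n, C (l - series (\val \o f \o d) n).
  move=> Df Nf; have /cvg_ex[/= l sl] : cvgn (series (\val \o f \o d)).
    apply: (@cvg_series_geometric _ _ _ (c * 2)) => n.
    rewrite (le_trans (val_le _))// renormed_normE -mulrA ler_pM2l//.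
    exact: le_trans (Nf _) (Nd n).
  exists l => // n; apply: (cone_le_lim_cst (ra_closed (j := j) (Xp := Xp)) _ sl).
  exists n => // m /= nm; rewrite /cone_le sub_series_geq//.
  elim/big_ind : _ => //; first exact: cone0.
  - by move=> a b; exact: coneD.
  - by move=> i _; exact: Df.
have Npos y : N (vpos D y) <= N y.
  apply: span_norm_homo; rewrite (vabs_id latD); last exact: (vpos_ge0 latD).
  exact: (vpos_le_vabs latD).
have [y ys Cy] := series_cvg _ (vpos_ge0 latD) Npos.
have [z zs Cz] : exists2 l, series (\val \o (fun y => vpos D (- y)) \o d) @ \oo --> l &
    forall n, C (l - series (\val \o (fun y => vpos D (- y)) \o d) n).
  apply: series_cvg => w; first exact: (vpos_ge0 latD).
  by rewrite (le_trans (Npos _))// /N (vabsN latD).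
move: ys Cy zs Cz; set Y := series _; set Y' := series _ => ys Cy zs Cz.
have Y0 : Y 0%N = 0 by rewrite /Y /series/= big_geq.
have Y'0 : Y' 0%N = 0 by rewrite /Y' /series/= big_geq.
have YS n : Y n.+1 = Y n + \val (vpos D (d n)) by rewrite /Y seriesSr.
have Y'S n : Y' n.+1 = Y' n + \val (vpos D (- d n)) by rewrite /Y' seriesSr.
have Cy0 : C y by have := Cy 0%N; rewrite Y0 subr0.
have Cz0 : C z by have := Cz 0%N; rewrite Y'0 subr0.
(* The initial term plus all positive increments minus all negative ones; [l - x n] is then a
   difference of two remainders in [C], to which [span_norm_le] applies. *)
pose l : S := (x 0%N : S) + span_sub Cy0 - span_sub Cz0.
have xE n : \val (l - (x n : S)) = (y - Y n) - (z - Y' n).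
  elim: n => [|n IHn].
    rewrite Y0 Y'0 !subr0 /l !span_valD !span_valN !span_subK.
    by move: (\val (x 0%N : S)) => w; abel.
  have -> : l - (x n.+1 : S) = (l - (x n : S)) - d n.
    by rewrite /d opprB addrA subrK.
  rewrite span_valD span_valN IHn YS Y'S.
  have -> : \val (d n) = \val (vpos D (d n)) - \val (vpos D (- d n)).
    by rewrite -span_valN -span_valD (vposN latD) opprB addrC subrK.
  move: (\val (vpos D (d n))) (\val (vpos D (- d n))) (Y n) (Y' n) => u v a b.
  abel.
have xl : N (l - x n) @[n --> \oo] --> 0.
  have cvg0 u a : u @ \oo --> a -> `|E (a - u n)| @[n --> \oo] --> 0.
    move=> ua; have : a - u n @[n --> \oo] --> 0.
      by rewrite -(subrr a); apply: cvgB => //; exact: cvg_cst.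
    rewrite -(normr0 X) -(linear0 E) => au; apply: cvg_norm.
    by apply: (continuous_cvg (h := E) _ _ au); exact: (ra_Econt ra).
  have yz0 : `|E (y - Y n)| + `|E (z - Y' n)| @[n --> \oo] --> 0.
    by rewrite -[0]addr0; apply: cvgD; exact: cvg0.
  apply: (squeeze_cvgr _ (cvg_cst 0) yz0).
  apply: nearW => n; rewrite -[N _]/(`|(l : W) - x n|) normr_ge0.
  exact: (span_norm_le (Cy n) (Cz n) (xE n)).
by apply/cvg_ex; exists (l : W); exact: cvg_of_dist.
Qed.

Lemma renormed_banach_lattice : banach_lattice (E := W) D.
Proof.
split; first split.
- exact: renormed_complete.
- exact: span_is_cone.
- exact: renormed_cone_closed.
- exact: span_lattice.
- exact: span_norm_homo.
Qed.

(* Monotone nets converge in the new norm as soon as their images under the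
   resolvent converge, although the inverse of [E] is not positive. *)
Lemma renormed_net_cvg (I : Type) (le : I -> I -> Prop) (u : I -> W) :
  directed le -> increasing_net le D u ->
  cvg (E (\val (u i : S)) @[i --> tails le]) -> cvg (u @ tails le).
Proof.
move=> dir_le incu Eu.
have tailsF := tails_proper dir_le.
have /cvg_ex[/= z uz] : cvg (\val (u i : S) @[i --> tails le]).
  exact: (ra_E_is_cvg ra).
have uz_le i : \val (u i : S) ≦ z.
  apply: (increasing_net_le_lim (ra_closed (j := j) (Xp := Xp)) _ dir_le _ uz).
  by move=> k l kl; rewrite -span_leE; exact: incu.
have [[i0 _] _ _ _] := dir_le.
(* The limit [z] belongs to the span because it differs from a member of the net by an element of
   the cone. *)
pose l : S := (u i0 : S) + span_sub (uz_le i0).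
have lz : \val l = z by rewrite span_valD span_subK addrC subrK.
have Eul : E (\val (u i : S)) @[i --> tails le] --> E z.
  by apply: (continuous_cvg (h := E) _ _ uz); exact: (ra_Econt ra).
suff ul : u @ tails le --> (l : W) by exact: cvgP ul.
apply: cvg_of_dist.
have Dlu i : D (l - (u i : S)).
  by rewrite span_coneE span_valD span_valN lz; exact: uz_le.
(* Since [l - u i] is positive, no modulus intervenes in its new norm. *)
have -> : (fun i => `|(l : W) - u i|) = fun i => `|E z - E (\val (u i : S))|.
  apply/funext => i.
  by rewrite renormed_normE span_norm_ge0E// span_valD span_valN lz linearB.
rewrite -(normr0 X) -(subrr (E z)); apply: cvg_norm.
by apply: cvgB => //; exact: cvg_cst.
Qed.

Lemma renormed_order_continuous : order_continuous_norm (E := W) D.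
Proof.
move=> I le u dir_le incu u0 [a [b uab]]; apply: renormed_net_cvg => //.
apply: (ocX dir_le).
- by move=> i k ik; apply: span_E_homo; exact: incu.
- by move=> i; apply: span_E_ge0; exact: u0.
- by exists (E (\val (a : S))), (E (\val (b : S))) => i; split;
    apply: span_E_homo; case: (uab i).
Qed.

Lemma renormed_KB : KB_space Xp -> KB_space (E := W) D.
Proof.
move=> [_ kbX]; split; first exact: renormed_banach_lattice.
move=> I le u dir_le incu [M [Mreal uM]]; apply: renormed_net_cvg => //.
apply: (kbX _ _ _ dir_le).
  by move=> i k ik; apply: span_E_homo; exact: incu.
exists M; split=> // r Mr _ [i _ <-].
apply: (le_trans (norm_E_le (u i : S))).
by apply: (uM r Mr (u i)); exists i.
Qed.

Let closure_decomp x : exists y z, [/\ C y, C z & j x = y - z].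
Proof.
exists (j (vpos Xp x)), (j (vpos Xp (- x))); split.
- exact/ra_image/(vpos_ge0 latX).
- exact/ra_image/(vpos_ge0 latX).
- by rewrite -linearB (vposN latX) opprB addrC subrK.
Qed.

Let span_embed_subproof x : j x \in lin_span C.
Proof. by rewrite inE lin_spanE//; exact: closure_decomp. Qed.

Definition span_embed (x : X) : S := Sub (j x) (span_embed_subproof x).

Lemma span_embedK x : \val (span_embed x) = j x. Proof. exact: SubK. Qed.

Lemma span_embed_linear : linear span_embed.
Proof.
move=> a x y; apply: val_inj.
by rewrite span_valD span_valZ !span_embedK linearP.
Qed.

HB.instance Definition _ :=
  GRing.isLinear.Build R X S *:%R span_embed span_embed_linear.

Lemma span_embed_le x y : (span_embed x ⊑ span_embed y) <-> (x ⪯ y).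
Proof. by rewrite span_leE !span_embedK /cone_le -linearB; exact: (ra_imageP blX ra). Qed.

(** An upper bound [u] in the span may lie outside [X]. It is therefore compared with the supremum
    of [P n (j x)] and [P n (j y)] after applying [P n], and then [n] tends to infinity. *)
Lemma span_embed_vsup x y :
  span_embed (vsup Xp x y) = vsup D (span_embed x) (span_embed y).
Proof.
apply/esym/(vsup_eq coneD_); split.
- exact/span_embed_le/(le_vsupl latX).
- exact/span_embed_le/(le_vsupr latX).
- move=> u; rewrite !span_leE !span_embedK => /(ra_leP blX ra) xu /(ra_leP blX ra) yu.
  have sup_cvg : vsup Xp (P n (j x)) (P n (j y)) @[n --> \oo] --> vsup Xp x y.
    under eq_fun do rewrite vsupE//; rewrite vsupE//.
    apply: cvgD; first exact: (ra_id ra).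
    by apply: (cvg_vpos blX); apply: cvgB; exact: (ra_id ra).
  have jsup_cvg : j (vsup Xp (P n (j x)) (P n (j y))) @[n --> \oo] -->
      j (vsup Xp x y).
    by apply: (continuous_cvg (h := j) _ _ sup_cvg); exact: (ra_jcont ra).
  apply: (cone_le_lim (ra_closed (j := j) (Xp := Xp)) _ jsup_cvg
    (ra_jP_cvg ra (z := \val u))).
  apply: nearW => n; rewrite /cone_le -linearB; apply: ra_image.
  by apply: (vsup_le latX).
Qed.

Lemma span_embed_vabs x : vabs D (span_embed x) = span_embed (vabs Xp x).
Proof. by rewrite /vabs span_embed_vsup linearN. Qed.

Lemma span_embed_ideal : lattice_ideal D (range span_embed).
Proof.
split; first split.
- by exists 0; rewrite ?linear0.
- by move=> a _ _ [x _ <-] [y _ <-]; exists (a *: x + y); rewrite ?linearP.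
move=> x _ /[swap] -[y _ <-]; rewrite span_embed_vabs => xy.
(* Both the positive and the negative part of [x] lie between [0] and the image of the modulus of
   [y], so [ra_ideal] applies to each. *)
have part w : vpos D w ⊑ vabs D x -> exists a, vpos D w = span_embed a.
  move=> wx; have [] := @ra_ideal _ _ _ _ _ _ _ blX ra ocX (\val (vpos D w))
    (vabs Xp y).
  - exact: (vpos_ge0 latD w).
  - by rewrite -span_embedK -span_leE; exact: (cone_le_trans coneD_ wx xy).
  - by move=> a wa; exists a; apply: val_inj; rewrite span_embedK.
have [a xa] := part x (vpos_le_vabs latD x).
have [b xb] : exists b, vpos D (- x) = span_embed b.
  by apply: part; rewrite -(vabsN latD); exact: (vpos_le_vabs latD).
exists (a - b) => //; rewrite linearB/= -xa -xb (vposN latD).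
by rewrite opprB addrC subrK.
Qed.

End SpanLattice.
(** * Right derivatives *)

Section RightDerivative.
Context {R : realType}.

(** Continuity is relative to the half-line because the values of a semigroup at negative times are
    unconstrained. *)
Definition half_line_continuous {V : normedModType R} (f : R -> V) :=
  forall s : R, 0 <= s -> f @ within `[0, +oo[ (nbhs s) --> f s.

Definition right_derivative {V : normedModType R} (f : R -> V) (s : R) (d : V) :=
  h^-1 *: (f (s + h) - f s) @[h --> 0^'+] --> d.

Lemma half_line_continuousP {V : normedModType R} (f : R -> V) :
  {within `[0, +oo[, continuous f} <-> half_line_continuous f.
Proof.
rewrite subspace_continuousP; split=> fc s s0; apply: fc.
  by rewrite /= in_itv/= s0.
by move: s0; rewrite /= in_itv/= andbT.
Qed.

Lemma continuous_half_line {V : normedModType R} (f : R -> V) :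
  continuous f -> half_line_continuous f.
Proof. by move=> fc s _; apply: cvg_within_filter; exact: fc. Qed.

Lemma is_derive_right (f : R -> R) (s d : R) : is_derive s 1 f d ->
  right_derivative f s d.
Proof.
move=> [fs <-]; apply: cvg_dnbhs_at_right.
apply: cvg_trans (fs : cvg_to _ _); apply: near_eq_cvg; near=> h.
by rewrite /= -[h *: 1]/(h * 1) mulr1 [h + s]addrC.
Unshelve. all: by end_near. Qed.

(** With slack [e * s], the set [A] of times where the bound holds contains its supremum by
    continuity, and the hypothesis moves past any element of [A] below [t]. *)
Lemma half_line_dini (phi : R -> R) t : 0 <= t -> half_line_continuous phi ->
  (forall s e : R, 0 <= s -> 0 < e ->
     \forall h \near 0^'+, phi (s + h) <= phi s + e * h) ->
  phi t <= phi 0.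
Proof.
move=> t0 phi_cont phi_dini.
suff phi_e e : 0 < e -> phi t <= phi 0 + e * t.
  apply/ler_addgt0Pr => e e0.
  (* The denominator is [t + 1] because [t] may vanish. *)
  have et0 : 0 < e / (t + 1) by rewrite divr_gt0// ltr_wpDl.
  apply: (le_trans (phi_e _ et0)); rewrite lerD2l -mulrA ler_piMr ?ltW//.
  by rewrite mulrC ltr_pdivrMr ?ltr_wpDl// mul1r ltrDl.
move=> e0; pose A := [set s | [/\ 0 <= s, s <= t & phi s <= phi 0 + e * s]].
have A0 : A 0 by split=> //; rewrite mulr0 addr0.
have supA : has_sup A by split; [exists 0|exists t => s []].
pose m := sup A.
have m0 : 0 <= m by exact: sup_upper_bound.
have mt : m <= t by apply: ge_sup; [exists 0|move=> s []].
have Am : phi m <= phi 0 + e * m.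
  rewrite leNgt; apply/negP => phim.
  have psi : phi s - e * s @[s --> within `[0, +oo[ (nbhs m)] --> phi m - e * m.
    apply: cvgB; first exact: phi_cont.
    apply: cvg_within_filter; apply: cvgMr; exact: cvg_id.
  have gap0 : 0 < phi m - e * m - phi 0 by rewrite subr_gt0 ltrBrDr.
  have /cvgrPdist_lt/(_ _ gap0) := psi.
  rewrite near_withinE => -[d /= d0 near_m].
  have [s As sm] := sup_adherent d0 supA; rewrite -/m in sm.
  have sm' : s <= m by exact: sup_upper_bound.
  case: (As) => s0 _ phis.
  have : `|phi m - e * m - (phi s - e * s)| < phi m - e * m - phi 0.
    apply: near_m; last by rewrite /= in_itv/= s0.
    by rewrite /ball_/= ger0_norm ?subr_ge0// ltrBlDr addrC -ltrBlDr.
  rewrite ltNge => /negP; apply; rewrite (le_trans _ (ler_norm _))//.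
  by rewrite lerB// lerBlDr.
have [<-//|tm] : m = t \/ m < t.
  by move: mt; rewrite le_eqVlt => /predU1P[]; [left|right].
have /filter_ex[h [h0 hmt]] : \forall h \near 0^'+, 0 < h /\ m + h <= t /\
    phi (m + h) <= phi m + e * h.
  near=> h; split; first by near: h; exact: nbhs_right_gt.
  split; last by near: h; exact: phi_dini.
  rewrite -lerBrDl; near: h; apply: nbhs_right_le; by rewrite subr_gt0.
have [mht phih] := hmt.
have : A (m + h).
  split=> //; first by rewrite addr_ge0// ltW.
  by rewrite mulrDr addrA (le_trans phih)// lerD2r.
by move/(sup_upper_bound supA); rewrite -/m gerDl leNgt h0.
Unshelve. all: by end_near. Qed.

(** [half_line_dini] applies to the norm of [f s - f 0] minus [g s]; the two difference quotients
    use half of the slack each. *)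
Lemma right_mean_value {V : normedModType R} (f : R -> V) (g : R -> R)
    (df : R -> V) (dg : R -> R) t : 0 <= t ->
  half_line_continuous f -> half_line_continuous g ->
  (forall s : R, 0 <= s -> right_derivative f s (df s)) ->
  (forall s : R, 0 <= s -> right_derivative g s (dg s)) ->
  (forall s : R, 0 <= s -> `|df s| <= dg s) ->
  `|f t - f 0| <= g t - g 0.
Proof.
move=> t0 f_cont g_cont f' g' fg.
pose phi s := `|f s - f 0| - g s.
have : phi t <= phi 0.
  apply: half_line_dini => // [s s0|s e s0 e0].
    apply: cvgB; last exact: g_cont.
    by apply: cvg_norm; apply: cvgB; [exact: f_cont|exact: cvg_cst].
  have e20 : 0 < e / 2 by rewrite divr_gt0.
  near=> h; have h0 : 0 < h by near: h; exact: nbhs_right_gt.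
  have fh : `|df s - h^-1 *: (f (s + h) - f s)| < e / 2.
    by near: h; apply: cvgr_dist_lt => //; exact: f'.
  have gh : `|dg s - h^-1 * (g (s + h) - g s)| < e / 2.
    by near: h; apply: cvgr_dist_lt => //; exact: g'.
  have {}fh : `|f (s + h) - f s| <= h * (dg s + e / 2).
    have -> : f (s + h) - f s = h *: (h^-1 *: (f (s + h) - f s)).
      by rewrite scalerA divff ?scale1r// gt_eqF.
    rewrite normrZ gtr0_norm// ler_pM2l//.
    have -> : h^-1 *: (f (s + h) - f s) =
        df s - (df s - h^-1 *: (f (s + h) - f s)) by rewrite subKr.
    by rewrite (le_trans (ler_normB _ _))// lerD ?fg// ltW.
  have {}gh : h * (dg s - e / 2) <= g (s + h) - g s.
    have -> : g (s + h) - g s = h * (h^-1 * (g (s + h) - g s)).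
      by rewrite mulrA divff ?mul1r// gt_eqF.
    rewrite ler_pM2l// lerBlDr -lerBlDl; apply: le_trans (ltW gh).
    exact: ler_norm.
  have ff : `|f (s + h) - f 0| <= `|f (s + h) - f s| + `|f s - f 0|.
    by rewrite (le_trans _ (ler_normD _ _))// addrA subrK.
  rewrite /phi; lra.
by rewrite /phi subrr normr0 add0r lerBlDr; lra.
Unshelve. all: by end_near. Qed.

End RightDerivative.

(** The norm of the positive part of [f s - f 0] has no growth, as the positive part is subadditive,
    contractive and vanishes on [df s]. *)
Lemma right_mean_value_cone {R : realType} {X : completeNormedModType R}
    {Xp : set X} (f df : R -> X) t :
  banach_lattice Xp -> 0 <= t -> half_line_continuous f ->
  (forall s : R, 0 <= s -> right_derivative f s (df s)) ->
  (forall s : R, 0 <= s -> Xp (- df s)) -> cone_le Xp (f t) (f 0).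
Proof.
move=> blX t0 f_cont f' df_le.
have latX := bl_lattice blX; have coneX := bl_cone blX.
pose phi s := `|vpos Xp (f s - f 0)|.
have phi0 : phi 0 = 0.
  by rewrite /phi subrr (vpos_id latX) ?normr0//; exact: (cone0 coneX).
have : phi t <= phi 0.
  apply: half_line_dini => // [s s0|s e s0 e0].
    apply: cvg_norm; apply: (cvg_vpos blX).
    by apply: cvgB; [exact: f_cont|exact: cvg_cst].
  near=> h; have h0 : 0 < h by near: h; exact: nbhs_right_gt.
  have qe : `|df s - h^-1 *: (f (s + h) - f s)| < e.
    by near: h; apply: cvgr_dist_lt => //; exact: f'.
  move: qe; set q := h^-1 *: _ => qe.
  have fq : f (s + h) - f s = h *: q.
    by rewrite /q scalerA divff ?scale1r// gt_eqF.
  have posq : `|vpos Xp q| <= e.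
    have df0 : vpos Xp (df s) = 0.
      apply: (cone_anti coneX); first exact: (vpos_ge0 latX).
      have : cone_le Xp (vpos Xp (df s)) 0.
        apply: (vpos_le latX); last exact: (cone0 coneX).
        by rewrite /cone_le sub0r; exact: df_le.
      by rewrite /cone_le sub0r.
    rewrite -[vpos Xp q]subr0 -df0 (le_trans (norm_vposB blX _ _))//.
    by rewrite distrC ltW.
  have -> : phi (s + h) = `|vpos Xp (h *: q + (f s - f 0))|.
    by rewrite -fq /phi addrA subrK.
  have := vposD latX (h *: q) (f s - f 0).
  move=> /(norm_cone_le blX (vpos_ge0 latX _))/le_trans; apply.
  rewrite (le_trans (ler_normD _ _))// addrC lerD2l (vposZ latX _ (ltW h0)).
  by rewrite normrZ (gtr0_norm h0) [e * h]mulrC ler_pM2l.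
rewrite phi0 normr_le0 => /eqP pos0.
have := le_vpos latX (f t - f 0); rewrite pos0 /cone_le; congr Xp; abel.
Unshelve. all: by end_near. Qed.

(** * Resolvents of a semigroup *)

Section Semigroup.
Context {R : realType} {X : completeNormedModType R} {T : R -> {linear X -> X}}.
Hypothesis C0T : C0_semigroup T.

Let Tcont t : 0 <= t -> continuous (T t). Proof. by case: C0T => + _ _ _; exact. Qed.
Let T0 x : T 0 x = x. Proof. by case: C0T. Qed.
Let TD s t x : 0 <= s -> 0 <= t -> T (s + t) x = T s (T t x).
Proof. by case: C0T => _ _ + _; exact. Qed.

Lemma orbit_continuous x : half_line_continuous (fun t => T t x).
Proof. by apply/half_line_continuousP; case: C0T => _ _ _; exact. Qed.

(** Orbits are bounded on the compact interval by continuity, and the uniform boundedness principle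
    makes the bound uniform in [x]. *)
Lemma semigroup_local_bound : exists2 K : R, 1 <= K &
  forall t x, 0 <= t -> t <= 1 -> `|T t x| <= K * `|x|.
Proof.
pose F : set (X -> X) := [set f : X -> X | exists2 t : R, 0 <= t <= 1 & f = T t].
have [f|x|M FM] := @Banach_Steinhauss _ X X F _ _ 1.
- move=> [t /andP[t0 _] ->]; split; last exact: linearP.
  have [c c0 Tc] := continuous_linear_bound (Tcont t0).
  move=> r; exists (c * r) => x xr.
  by rewrite (le_trans (Tc x))// ler_pM2l.
- have [|c _ cmax] := @EVT_max R (fun t => `|T t x|) 0 1 ler01.
    have sub : `[0, 1]%classic `<=` `[0 : R, +oo[%classic.
      by move=> t /=; rewrite !in_itv/= => /andP[-> _].
    apply: (continuous_subspaceW sub).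
    apply/half_line_continuousP => s s0; apply: cvg_norm.
    exact: orbit_continuous.
  exists `|T c x| => _ [t t01 ->]; apply: cmax.
  by rewrite in_itv.
(* The maximum with [1] makes [ln K], the exponent in [semigroup_growth], nonnegative. *)
exists (Num.max 1 M); first by rewrite le_max lexx.
move=> t x t0 t1; have [->|x0] := eqVneq x 0.
  by rewrite linear0 normr0 mulr0.
have nx0 : 0 < `|x| by rewrite normr_gt0.
have Tx1 : `|T t (`|x|^-1 *: x)| <= M.
  apply: FM; first by exists t => //; rewrite t0.
  by rewrite normrZ normfV normr_id mulVf ?gt_eqF.
rewrite linearZ/= normrZ normfV normr_id ler_pdivrMl// in Tx1.
by rewrite (le_trans Tx1)// mulrC ler_pM2r// le_max lexx orbT.
Qed.

(** Each further unit of time costs a factor [K], that is [expR (ln K)]. *)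
Lemma semigroup_growth : exists K w : R, [/\ 0 < K, 0 <= w &
  forall t x, 0 <= t -> `|T t x| <= K * expR (w * t) * `|x|].
Proof.
have [K K1 TK] := semigroup_local_bound; exists K, (ln K).
have K0 : 0 < K by exact: lt_le_trans ltr01 K1.
have w0 : 0 <= ln K by rewrite ln_ge0.
split=> // t x t0.
have [n tn] : exists n : nat, t <= n.+1%:R.
  exists (Num.bound t); rewrite ltW// (lt_trans (archi_boundP t0))// ltr_nat.
  exact: ltnSn.
elim: n t t0 tn => [|n IHn] t t0 tn.
  rewrite (le_trans (TK _ _ t0 tn))// ler_wpM2r// (ler_peMr (ltW K0))//.
  by rewrite -expR0 ler_expR mulr_ge0.
have [t1|t1] := leP t 1.
  rewrite (le_trans (TK _ _ t0 t1))// ler_wpM2r// (ler_peMr (ltW K0))//.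
  by rewrite -expR0 ler_expR mulr_ge0.
have t10 : 0 <= t - 1 by rewrite subr_ge0 ltW.
have -> : T t x = T 1 (T (t - 1) x) by rewrite -TD// addrC subrK.
rewrite (le_trans (TK _ _ _ _))//.
have -> : K * expR (ln K * t) * `|x| = K * (K * expR (ln K * (t - 1)) * `|x|).
  by rewrite -[in LHS](subrK 1 t) mulrDr mulr1 expRD lnK ?posrE//; ring.
by rewrite ler_pM2l// IHn// lerBlDr natr1.
Qed.

Lemma gen_cvg x : gen_dom T x ->
  h^-1 *: (T h x - x) @[h --> 0^'+] --> gen T x.
Proof. by []. Qed.

Lemma gen_eq x y : h^-1 *: (T h x - x) @[h --> 0^'+] --> y ->
  gen_dom T x /\ gen T x = y.
Proof. by move=> xy; split; [exact: cvgP xy|exact/cvg_lim]. Qed.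

Lemma genP a x y : gen_dom T x -> gen_dom T y ->
  gen_dom T (a *: x + y) /\ gen T (a *: x + y) = a *: gen T x + gen T y.
Proof.
move=> /gen_cvg gx /gen_cvg gy; apply: gen_eq.
rewrite (_ : (fun h => _) = fun h : R =>
    a *: (h^-1 *: (T h x - x)) + h^-1 *: (T h y - y)); last first.
  apply/funext => h; rewrite linearP; move: (T h x) (T h y) => u v.
  have -> : a *: u + v - (a *: x + y) = a *: (u - x) + (v - y).
    by rewrite scalerBr opprD addrACA.
  by rewrite scalerDr !scalerA [h^-1 * a]mulrC.
by apply: cvgD => //; apply: cvgZr.
Qed.

Lemma gen0 : gen_dom T 0 /\ gen T 0 = 0.
Proof.
apply: gen_eq; rewrite (_ : (fun h => _) = cst 0); first exact: cvg_cst.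
by apply/funext => h; rewrite linear0 subrr scaler0.
Qed.

Definition is_resolvent (mu : R) (Q : X -> X) :=
  (forall x, gen_dom T (Q x) /\ mu *: Q x - gen T (Q x) = x) /\
  (forall y, gen_dom T y -> Q (mu *: y - gen T y) = y).

(** At a real point the complexified operator acts on each component separately, so the first
    component of the complex resolvent at [(x, 0)] is the real one. *)
Lemma resolvent_exists (mu : R) : ~ gen_spectrum T (mu%:C)%C ->
  exists2 Q : {linear X -> X}, continuous Q & is_resolvent mu Q.
Proof.
move=> /contrapT[B [Bcont Bdom Beq Binv]].
have csg u : complex_sub_gen T (mu%:C)%C u =
    (mu *: u.1 - gen T u.1, mu *: u.2 - gen T u.2).
  by rewrite /complex_sub_gen/= !scale0r subr0 addr0.
pose q x := (B (x, 0)).1.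
have q_dom x : gen_dom T (q x) by case: (Bdom (x, 0)).
have q_eq x : mu *: q x - gen T (q x) = x.
  by have := Beq (x, 0); rewrite csg => -[].
have q_inv y : gen_dom T y -> q (mu *: y - gen T y) = y.
  move=> ydom; have [dom0 g0] := gen0.
  have := Binv (y, 0) ydom dom0.
  by rewrite csg/= scaler0 g0 subr0 /q => ->.
have q_linear : linear q.
  move=> a x y; have [dom g] := genP a (q_dom x) (q_dom y).
  rewrite -[in RHS](q_inv _ dom) g; congr q.
  have ax : a *: x = mu *: (a *: q x) - a *: gen T (q x).
    by rewrite -{1}(q_eq x) scalerBr !scalerA mulrC.
  by rewrite ax -{1}(q_eq y) scalerDr opprD addrACA.
have q_cont : continuous q.
  move=> x; apply: (@continuous_comp _ _ _ (fun x => B (x, 0)) fst).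
    apply: (@continuous_comp _ _ _ (fun x : X => (x, 0 : X)) B).
      by apply: cvg_pair; [exact: cvg_id|exact: cvg_cst].
    exact: Bcont.
  exact: cvg_fst.
pose Q : {linear X -> X} := HB.pack q (GRing.isLinear.Build _ _ _ _ q q_linear).
by exists Q.
Qed.

Lemma resolvent_unique mu (Q : X -> X) x y : is_resolvent mu Q ->
  gen_dom T y -> mu *: y - gen T y = x -> y = Q x.
Proof. by move=> [_ Qinv] ydom <-; rewrite Qinv. Qed.

Lemma gen_resolventE mu (Q : X -> X) x : is_resolvent mu Q ->
  gen_resolvent T mu x = Q x.
Proof.
move=> resQ; rewrite /gen_resolvent; case: xgetP => [y _ [ydom yx]|none].
  exact: (resolvent_unique resQ).
by have [dom e] := resQ.1 x; have := none (Q x); case.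
Qed.

Lemma resolvent_identity mu nu (Q Q' : {linear X -> X}) x :
  is_resolvent mu Q -> is_resolvent nu Q' ->
  Q' x = Q x + (mu - nu) *: Q (Q' x).
Proof.
move=> resQ resQ'; have [dom e] := resQ'.1 x.
rewrite -linearZ -linearD; apply: (resolvent_unique resQ dom).
by rewrite -[X in _ = X + _]e scalerBl; abel.
Qed.

(** For distinct points the resolvent identity, written in both orders, expresses both products
    through the same difference; for equal points the resolvents coincide. *)
Lemma resolvent_comm mu nu (Q Q' : {linear X -> X}) x :
  is_resolvent mu Q -> is_resolvent nu Q' -> Q (Q' x) = Q' (Q x).
Proof.
move=> resQ resQ'; have [mn|mn] := eqVneq mu nu.
  have QQ' z : Q z = Q' z.
    by have [dom e] := resQ.1 z; rewrite mn in e; exact: (resolvent_unique resQ' dom e).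
  by rewrite !QQ'.
have e1 : (mu - nu) *: Q (Q' x) = Q' x - Q x.
  apply: (addrI (Q x)); rewrite -(resolvent_identity x resQ resQ').
  by rewrite addrC subrK.
have e2 : (nu - mu) *: Q' (Q x) = Q x - Q' x.
  apply: (addrI (Q' x)); rewrite -(resolvent_identity x resQ' resQ).
  by rewrite addrC subrK.
have /eqP : (mu - nu) *: (Q (Q' x) - Q' (Q x)) = 0.
  by rewrite scalerBr e1 -[mu - nu]opprB scaleNr e2; abel.
by rewrite scaler_eq0 subr_eq0 (negPf mn)/= subr_eq0 => /eqP.
Qed.

Lemma damped_exp_continuous (k : R) : continuous (fun s => expR (- (k * s))).
Proof.
move=> s; apply: (@continuous_comp _ _ _ (fun s => - (k * s)) expR).
  by apply: cvgN; apply: cvgMr; exact: cvg_id.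
exact: continuous_expR.
Qed.

Lemma damped_orbit_continuous (k : R) x :
  half_line_continuous (fun s => expR (- (k * s)) *: T s x).
Proof.
move=> s s0; apply: cvgZ; last exact: orbit_continuous.
by apply: cvg_within_filter; exact: damped_exp_continuous.
Qed.

Lemma damped_exp_derive (k s : R) :
  is_derive s 1 (fun s => expR (- (k * s))) (- k * expR (- (k * s))).
Proof.
have k' : is_derive s 1 (fun s => - (k * s)) (- k).
  by apply: is_derive_eq; rewrite scaler1.
have := @is_derive1_comp _ expR (fun s => - (k * s)) s _ _ (is_derive_expR _) k'.
by rewrite mulrC.
Qed.

(** The semigroup law writes the difference quotient at [s] as the damped operator at [s] applied to
    the quotient [r] at [0]. *)
Lemma damped_orbit_derivative (k : R) x s : 0 <= s -> gen_dom T x ->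
  right_derivative (fun s => expR (- (k * s)) *: T s x) s
    (- (expR (- (k * s)) *: T s (k *: x - gen T x))).
Proof.
move=> s0 xdom; rewrite /right_derivative.
pose r h := h^-1 *: (expR (- (k * h)) *: T h x - x).
have r_cvg : r h @[h --> 0^'+] --> - (k *: x - gen T x).
  have e' := is_derive_right (damped_exp_derive k 0).
  rewrite /right_derivative mulr0 oppr0 expR0 mulr1 in e'.
  rewrite (_ : r = fun h => expR (- (k * h)) *: (h^-1 *: (T h x - x)) +
      (h^-1 *: (expR (- (k * (0 + h))) - 1)) *: x); last first.
    apply/funext => h; rewrite /r add0r; move: (expR _) (T h x) => c u.
    have -> : c *: u - x = c *: (u - x) + (c - 1) *: x.
      by rewrite scalerBr scalerBl scale1r addrA subrK.
    by rewrite scalerDr !scalerA [h^-1 * c]mulrC.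
  rewrite opprB; apply: cvgD; last by rewrite -scaleNr; exact: cvgZl.
  rewrite -[gen T x]scale1r; apply: cvgZ; last exact: gen_cvg.
  apply: cvg_at_right_filter.
  by have := @damped_exp_continuous k 0; rewrite /continuous_at mulr0 oppr0 expR0.
have : expR (- (k * s)) *: T s (r h) @[h --> 0^'+] -->
    expR (- (k * s)) *: T s (- (k *: x - gen T x)).
  apply: cvgZr; apply: (continuous_cvg (h := T s) _ _ r_cvg); exact: Tcont.
rewrite linearN scalerN; apply: cvg_trans; apply: near_eq_cvg; near=> h.
have h0 : 0 <= h by near: h; exact: nbhs_right_ge.
have -> : T s (r h) = h^-1 *: (expR (- (k * h)) *: T (s + h) x - T s x).
  by rewrite TD// -linearZ -linearB -linearZ.
rewrite scalerA [_ * h^-1]mulrC -scalerA; congr (_ *: _).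
by rewrite scalerBr scalerA -expRD mulrDr opprD.
Unshelve. all: by end_near. Qed.

(** * Estimates under an exponential growth bound *)

Section Growth.
Context {K w : R}.
Hypothesis K0 : 0 < K.
Hypothesis growth : forall t x, 0 <= t -> `|T t x| <= K * expR (w * t) * `|x|.

Lemma damped_orbit_bound (k s : R) x : 0 <= s ->
  `|expR (- (k * s)) *: T s x| <= K * `|x| * expR (- ((k - w) * s)).
Proof.
move=> s0; rewrite normrZ ger0_norm ?expR_ge0//.
rewrite (le_trans (ler_wpM2l (expR_ge0 _) (growth x s0)))//.
have -> : - ((k - w) * s) = - (k * s) + w * s by ring.
by rewrite expRD le_eqVlt; apply/orP; left; apply/eqP; ring.
Qed.

Lemma damped_exp_cvg0 (k : R) : 0 < k -> expR (- (k * n%:R)) @[n --> \oo] --> 0.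
Proof.
move=> k0; under eq_fun do rewrite -mulNr expRM_natr.
by apply: cvg_expr; rewrite ger0_norm ?expR_ge0// expR_lt1 oppr_lt0.
Qed.

Lemma damped_orbit_cvg0 (k : R) x : w < k ->
  expR (- (k * n%:R)) *: T n%:R x @[n --> \oo] --> 0.
Proof.
move=> wk; apply/norm_cvg0P.
have : K * `|x| * expR (- ((k - w) * n%:R)) @[n --> \oo] --> 0.
  rewrite -(mulr0 (K * `|x|)); apply: cvgMr; apply: damped_exp_cvg0.
  by rewrite subr_gt0.
apply: squeeze_cvgr (cvg_cst 0); apply: nearW => n.
by rewrite normr_ge0 damped_orbit_bound.
Qed.

(** The damped orbit of [Q x] has derivative minus the damped orbit of [x], hence decreases; as it
    tends to zero, its initial value [Q x] is positive. *)
Lemma resolvent_positive (Xp : set X) (k : R) (Q : X -> X) x :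
  banach_lattice Xp -> positive_semigroup T Xp -> w < k -> is_resolvent k Q ->
  Xp x -> Xp (Q x).
Proof.
move=> blX Tpos wk resQ Xpx; have [dom e] := resQ.1 x.
have coneX := bl_cone blX.
apply: cone_le0.
apply: (cone_lim_le (bl_closed blX) _ (damped_orbit_cvg0 (Q x) wk)).
apply: nearW => n.
have := @right_mean_value_cone _ _ _ (fun s => expR (- (k * s)) *: T s (Q x))
  (fun s => - (expR (- (k * s)) *: T s (k *: Q x - gen T (Q x)))) n%:R blX.
rewrite mulr0 oppr0 expR0 T0 scale1r; apply=> //.
- exact: damped_orbit_continuous.
- by move=> s s0; exact: damped_orbit_derivative.
- move=> s s0; rewrite opprK e; apply: (coneZ coneX); first exact: expR_ge0.
  exact: Tpos.
Qed.

Lemma resolvent_estimate (mu nu a c : R) (Q : X -> X) x :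
  w <= mu -> 0 < nu -> is_resolvent (mu + nu) Q -> 0 <= a -> 0 <= c ->
  (forall s, 0 <= s -> `|expR (- (mu * s)) *: T s x - x| <= a + c * s) ->
  `|nu *: Q x - x| <= a + c / nu.
Proof.
move=> wmu nu0 resQ a0 c0 Tx; have [dom e] := resQ.1 x.
have nun0 : nu != 0 by rewrite gt_eqF.
pose k := mu + nu.
(* [f s] stands for the integral over times beyond [s] of [expR (- (nu * u))] times the defect
   [expR (- (mu * u)) *: T u x - x]. *)
pose f s := expR (- (k * s)) *: T s (Q x) - (nu^-1 * expR (- (nu * s))) *: x.
pose df s := - (expR (- (k * s)) *: T s x) - (- expR (- (nu * s))) *: x.
(* [g] is the primitive of [dg] that vanishes at infinity. *)
pose g s := - (a / nu + c * (s / nu + nu ^- 2)) * expR (- (nu * s)).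
pose dg s := expR (- (nu * s)) * (a + c * s).
have Q_nu : f 0 = Q x - nu^-1 *: x.
  by rewrite /f !mulr0 oppr0 expR0 T0 scale1r mulr1.
have f_cont : half_line_continuous f.
  move=> s s0; apply: cvgB; first exact: damped_orbit_continuous.
  apply: cvgZl; apply: cvgMr; apply: cvg_within_filter.
  exact: damped_exp_continuous.
have g_cont : half_line_continuous g.
  apply: continuous_half_line => s; apply: cvgM; last exact: damped_exp_continuous.
  apply: cvgN; apply: cvgD; first exact: cvg_cst.
  apply: cvgMr; apply: cvgD; last exact: cvg_cst.
  by apply: cvgMl; exact: cvg_id.
have f' s : 0 <= s -> right_derivative f s (df s).
  move=> s0.
  have := damped_orbit_derivative (k := k) s0 dom; rewrite e => fT.
  have eT := is_derive_right (damped_exp_derive nu s).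
  rewrite /right_derivative (_ : (fun h => _) = fun h =>
      h^-1 *: (expR (- (k * (s + h))) *: T (s + h) (Q x) -
        expR (- (k * s)) *: T s (Q x)) -
      (nu^-1 * (h^-1 *: (expR (- (nu * (s + h))) - expR (- (nu * s))))) *: x).
    apply: cvgB => //; apply: cvgZl.
    have : nu^-1 * (h^-1 *: (expR (- (nu * (s + h))) - expR (- (nu * s))))
        @[h --> 0^'+] --> nu^-1 * (- nu * expR (- (nu * s))).
      by apply: cvgMr; exact: eT.
    by rewrite mulNr mulrN mulKf.
  apply/funext => h; rewrite /f.
  move: (expR (- (nu * (s + h)))) (expR (- (nu * s))) => u v.
  move: (expR _ *: T _ _) (expR _ *: T _ _) => p q.
  have -> : (nu^-1 * (h^-1 *: (u - v))) *: x =
      h^-1 *: ((nu^-1 * u) *: x - (nu^-1 * v) *: x).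
    by rewrite -scalerBl scalerA -mulrBr mulrCA.
  by rewrite -scalerBr; congr (_ *: _); abel.
have g' s : 0 <= s -> right_derivative g s (dg s).
  move=> s0; apply: is_derive_right.
  have e' := damped_exp_derive nu s; apply: is_derive_eq.
  by rewrite /GRing.scale/= /dg; field.
have fg s : 0 <= s -> `|df s| <= dg s.
  move=> s0.
  have -> : df s = - (expR (- (nu * s)) *: (expR (- (mu * s)) *: T s x - x)).
    rewrite /df scaleNr opprK scalerBr scalerA -expRD opprB addrC.
    by congr (_ - expR _ *: _); rewrite /k; ring.
  by rewrite normrN normrZ ger0_norm ?expR_ge0// ler_wpM2l ?expR_ge0// Tx.
have f0 : `|f 0| <= a / nu + c / nu ^+ 2.
  have f_cvg0 : f n%:R @[n --> \oo] --> 0.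
    rewrite -[0]subr0; apply: cvgB.
      by apply: damped_orbit_cvg0; rewrite (le_lt_trans wmu)// ltrDl.
    rewrite -(scale0r x); apply: cvgZl; rewrite -(mulr0 nu^-1); apply: cvgMr.
    exact: damped_exp_cvg0.
  have : `|f n%:R - f 0| @[n --> \oo] --> `|0 - f 0|.
    by apply: cvg_norm; apply: cvgB => //; exact: cvg_cst.
  rewrite sub0r normrN => /cvgr_to_le; apply; apply: nearW => n.
  (* As [g] is nonpositive, the increment [g n%:R - g 0] is at most [- g 0], the claimed bound. *)
  rewrite (le_trans (right_mean_value _ f_cont g_cont f' g' fg))//.
  rewrite /g mulr0 oppr0 expR0 mul0r add0r mulr1 opprK.
  rewrite -[leRHS]add0r lerD2r// mulNr oppr_le0.
  apply: mulr_ge0; last exact: expR_ge0.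
  apply: addr_ge0; first by rewrite divr_ge0// ltW.
  apply: mulr_ge0 => //; apply: addr_ge0; first by rewrite divr_ge0// ltW.
  by rewrite invr_ge0 exprn_ge0// ltW.
have -> : nu *: Q x - x = nu *: f 0.
  by rewrite Q_nu scalerBr scalerA divff// scale1r.
rewrite normrZ gtr0_norm// (le_trans (ler_wpM2l (ltW nu0) f0))//.
by rewrite le_eqVlt; apply/orP; left; apply/eqP; field.
Qed.

Lemma resolvent_approximates (mu : R) (Q : nat -> X -> X) x : w <= mu ->
  (forall n, is_resolvent (mu + n.+1%:R) (Q n)) ->
  n.+1%:R *: Q n x @[n --> \oo] --> x.
Proof.
move=> wmu resQ; apply/cvgrPdist_lt => e e0.
have e20 : 0 < e / 2 by rewrite divr_gt0.
have := @damped_orbit_continuous mu x 0 (lexx 0).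
rewrite mulr0 oppr0 expR0 T0 scale1r => /cvgrPdist_lt/(_ _ e20).
rewrite near_withinE => -[d /= d0 near0].
(* Before time [d] continuity keeps the defect below [e / 2]; from [d] on, the crude bound
   [(K + 1) * |x|] is at most [c * s]. *)
pose c := (K + 1) * `|x| / d.
have K10 : 0 <= K + 1 by rewrite addr_ge0// ltW.
have c0 : 0 <= c by rewrite divr_ge0 ?(ltW d0)// mulr_ge0.
have Tx s : 0 <= s -> `|expR (- (mu * s)) *: T s x - x| <= e / 2 + c * s.
  move=> s0; have [sd|ds] := ltP s d.
    have /ltW near_s : `|x - expR (- (mu * s)) *: T s x| < e / 2.
      apply: near0; last by rewrite /= in_itv/= s0.
      by rewrite /ball_/= sub0r normrN ger0_norm.
    by rewrite distrC (le_trans near_s)// lerDl mulr_ge0.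
  have Tbound := damped_orbit_bound mu x s0.
  have {}Tbound : `|expR (- (mu * s)) *: T s x| <= K * `|x|.
    rewrite (le_trans Tbound)// ler_piMr//; first by rewrite mulr_ge0// ltW.
    by rewrite expR_le1 oppr_le0 mulr_ge0// subr_ge0.
  have xs : (K + 1) * `|x| <= c * s.
    by rewrite /c -mulrA ler_peMr ?mulr_ge0// mulrC ler_pdivlMr ?mul1r.
  rewrite (le_trans (ler_normB _ _))//.
  by move: Tbound xs; rewrite mulrDl mul1r; lra.
near=> n; rewrite distrC.
apply: (le_lt_trans (resolvent_estimate wmu _ (resQ n) (ltW e20) c0 Tx)) => //.
rewrite [ltRHS](splitr e) ltrD2l ltr_pdivrMr// mulrC -ltr_pdivrMr//.
apply: (@lt_trans _ _ n%:R); last by rewrite ltr_nat.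
by near: n; exact: nbhs_infty_gtr.
Unshelve. all: by end_near. Qed.

End Growth.

End Semigroup.

Arguments is_resolvent {R X} T mu Q.

(** * The theorem *)

Section DenseExtension.
Context {R : realType} {X Z : normedModType R} (j : {linear X -> Z}).
Hypothesis dense_j : dense (range j).

Lemma dense_range_ind (A : set Z) : closed A -> (forall x, A (j x)) ->
  forall z, A z.
Proof.
move=> clA Aj z; apply: contrapT => NAz.
have [|] := dense_j (O := ~` A) _ (closed_openC clA); first by exists z.
by move=> w [NAw [x _ jx]]; apply: NAw; rewrite -jx.
Qed.

Lemma dense_range_eq {Y : normedModType R} (f g : Z -> Y) :
  continuous f -> continuous g -> (forall x, f (j x) = g (j x)) -> f =1 g.
Proof.
move=> fc gc fg z; apply/eqP; rewrite -subr_eq0 -normr_le0.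
have : closed [set z | `|f z - g z| <= 0].
  apply: (closed_comp (f := fun z => `|f z - g z|)) (@closed_le R 0) => {}z _.
  by apply: cvg_norm; apply: cvgB; [exact: fc|exact: gc].
by move=> /dense_range_ind; apply=> x /=; rewrite fg subrr normr0.
Qed.

(** Bounding [f] by the norm of [j x] makes it send sequences whose images under [j] converge to
    Cauchy sequences. *)
Lemma dense_range_extension {Y : completeNormedModType R} (f : {linear X -> Y})
    (c : R) : 0 < c -> (forall x, `|f x| <= c * `|j x|) ->
  exists2 g : {linear Z -> Y}, continuous g & forall x, g (j x) = f x.
Proof.
move=> c0 fj.
have seq_ex (z : Z) : exists v : nat -> X, j (v n) @[n --> \oo] --> z.
  have /choice[v vP] (n : nat) : exists x, `|z - j x| < 2^-1 ^+ n.
    have q0 : 0 < 2^-1 ^+ n :> R by rewrite exprn_gt0 ?invr_gt0.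
    have [||y [zy [x _ jx]]] := dense_j (O := ball z (2^-1 ^+ n)).
    - by exists z; exact: ballxx.
    - exact: ball_open.
    - by move: zy; rewrite -jx -ball_normE/= => zx; exists x.
  exists v; apply: cvg_of_dist.
  apply: (squeeze_cvgr _ (cvg_cst 0) half_expr_cvg0).
  by apply: nearW => n; rewrite normr_ge0 ltW.
have [v vz] := choice seq_ex.
have f_cvg (u : nat -> X) (z : Z) : j (u n) @[n --> \oo] --> z ->
    cvg (f (u n) @[n --> \oo]).
  move=> uz; apply: (@cvg_of_dominated _ _ _ _ _ _ (fun n => j (u n)) _ _ c0).
    by move=> s t; rewrite -!linearB.
  by apply/cvg_ex; exists z.
pose g (z : Z) : Y := lim (f (v z n) @[n --> \oo]).
(* The limit does not depend on the approximating sequence, which yields linearity and the value at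
   [j x]. *)
have gP (u : nat -> X) (z : Z) : j (u n) @[n --> \oo] --> z ->
    f (u n) @[n --> \oo] --> g z.
  move=> uz; have vg : f (v z n) @[n --> \oo] --> g z by exact: f_cvg _ _ (vz z).
  rewrite (_ : (fun n => _) = fun n => f (v z n) + f (u n - v z n)); last first.
    by apply/funext => n; rewrite -linearD addrC subrK.
  rewrite -[g z]addr0; apply: cvgD => //; apply/norm_cvg0P.
  have : c * `|j (u n) - j (v z n)| @[n --> \oo] --> 0.
    rewrite -(mulr0 c); apply: cvgMr; rewrite -(normr0 Z) -(subrr z).
    by apply: cvg_norm; apply: cvgB => //; exact: vz.
  apply: squeeze_cvgr (cvg_cst 0); apply: nearW => n.
  by rewrite normr_ge0/= (le_trans (fj _))// linearB.
have g_linear : linear g.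
  move=> a z z'.
  have : f (a *: v z n + v z' n) @[n --> \oo] --> g (a *: z + z').
    apply: gP; under eq_fun do rewrite linearP.
    by apply: cvgD; [apply: cvgZr|]; exact: vz.
  under eq_fun do rewrite linearP.
  move=> /cvg_lim <-//; apply/cvg_lim => //.
  by apply: cvgD; [apply: cvgZr|]; apply: gP; exact: vz.
have gj x : g (j x) = f x.
  have fx : f x @[_ --> \oo] --> g (j x) by apply: gP; exact: cvg_cst.
  by apply: (cvg_unique _ fx) => //; exact: cvg_cst.
have g_le z : `|g z| <= c * `|z|.
  have gz : `|f (v z n)| @[n --> \oo] --> `|g z| by apply: cvg_norm; exact: gP.
  have cz : c * `|j (v z n)| @[n --> \oo] --> c * `|z|.
    by apply: cvgMr; apply: cvg_norm; exact: vz.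
  by apply: ler_cvg_to gz cz _; apply: nearW => n; exact: fj.
pose G : {linear Z -> Y} := HB.pack g (GRing.isLinear.Build _ _ _ _ g g_linear).
exists G => //; apply: (bounded_additive_continuous c0) g_le.
exact: (linearB G).
Qed.

End DenseExtension.

(** By the resolvent identity and commutation, [Q'] is a bounded operator applied after [Q]. The
    norm of [Z], given by the resolvent at [lambda], can thus be measured at any other point. *)
Lemma resolvent_equiv {R : realType} {X : completeNormedModType R}
    {T : R -> {linear X -> X}} mu nu (Q Q' : {linear X -> X}) :
  continuous Q' -> is_resolvent T mu Q -> is_resolvent T nu Q' ->
  exists2 c : R, 0 < c & forall x, `|Q' x| <= c * `|Q x|.
Proof.
move=> Q'c resQ resQ'; have [K K0 Q'K] := continuous_linear_bound Q'c.
exists (1 + `|mu - nu| * K); first by rewrite ltr_wpDr// mulr_ge0// ltW.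
move=> x; rewrite (resolvent_identity x resQ resQ').
rewrite (le_trans (ler_normD _ _))// mulrDl mul1r lerD2l normrZ -mulrA.
by rewrite ler_wpM2l// (resolvent_comm _ resQ resQ').
Qed.

(** [E] extends the resolvent at [mu] and [P n] extends [n.+1] times the resolvent at [mu + n.+1].
    Identities on [Z] are checked on the dense range of [j], where they express that resolvents
    commute. *)
Lemma resolvent_approximation_exists {R : realType} {X : completeNormedModType R}
    (Xp : set X) (T : R -> {linear X -> X}) (lambda : R)
    (Z : completeNormedModType R) (j : {linear X -> Z}) :
  banach_lattice Xp -> C0_semigroup T -> positive_semigroup T Xp ->
  (forall z : R[i], gen_spectrum T z -> complex.Re z < lambda) ->
  extrapolation_space T lambda j ->
  exists (E : {linear Z -> X}) (P : nat -> {linear Z -> X}),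
    resolvent_approximation Xp j E P.
Proof.
move=> blX C0T Tpos spec [jnorm jdense].
have [K [w [K0 w0 growth]]] := semigroup_growth C0T.
have resolvent mu : lambda <= mu ->
    exists Q : {linear X -> X}, continuous Q /\ is_resolvent T mu Q.
  move=> lm; have [|Q Qc resQ] := @resolvent_exists _ _ T mu.
    by move=> /spec /=; rewrite ltNge lm.
  by exists Q.
(* Above [lambda] the resolvents exist; above the growth exponent [w] they are positive and
   approximate the identity. *)
pose mu := Num.max lambda w + 1.
have lmu : lambda <= mu.
  by rewrite -[lambda]addr0 lerD// le_max lexx.
have wmu : w < mu.
  by rewrite -[w]addr0 ler_ltD// le_max lexx orbT.
have [L [Lc resL]] := resolvent _ (lexx lambda).
have [Q0 [Q0c resQ0]] := resolvent _ lmu.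
have /choice[Q QP] (n : nat) : exists Q : {linear X -> X},
    continuous Q /\ is_resolvent T (mu + n.+1%:R) Q.
  by apply: resolvent; rewrite (le_trans lmu)// lerDl.
have Qc n : continuous (Q n) by case: (QP n).
have resQ n : is_resolvent T (mu + n.+1%:R) (Q n) by case: (QP n).
have jL x : `|j x| = `|L x| by rewrite jnorm (gen_resolventE _ resL).
have [c c0 Q0L] := resolvent_equiv Q0c resL resQ0.
have [E Ec Ej] : exists2 E : {linear Z -> X}, continuous E &
    forall x, E (j x) = Q0 x.
  by apply: (dense_range_extension jdense c0) => x; rewrite jL.
have /choice[P PP] (n : nat) : exists P : {linear Z -> X}, continuous P /\
    forall x, P (j x) = n.+1%:R *: Q n x.
  have [d d0 QL] := resolvent_equiv (Qc n) resL (resQ n).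
  have [||P Pc Pj] := @dense_range_extension _ _ _ j jdense _
    (n.+1%:R \*: Q n) (n.+1%:R * d).
  - by rewrite mulr_gt0.
  - by move=> x; rewrite jL /= normrZ ger0_norm// -mulrA ler_pM2l.
  by exists P.
have Pc n : continuous (P n) by case: (PP n).
have Pj n x : P n (j x) = n.+1%:R *: Q n x by case: (PP n).
have jc : continuous j.
  have [d d0 Ld] := continuous_linear_bound Lc.
  apply: (bounded_additive_continuous d0); first exact: (linearB j).
  by move=> x; rewrite jL.
have QQ0 n x : Q0 (Q n x) = Q n (Q0 x) by exact: resolvent_comm resQ0 (resQ n).
have Q0pos x : Xp x -> Xp (Q0 x).
  exact: (resolvent_positive C0T growth blX Tpos wmu resQ0).
have Qpos n x : Xp x -> Xp (Q n x).
  apply: (resolvent_positive C0T growth blX Tpos _ (resQ n)).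
  by rewrite (lt_le_trans wmu)// lerDl.
have comp_cont (V1 V2 V3 : normedModType R) (f : V1 -> V2) (g : V2 -> V3) :
    continuous f -> continuous g -> continuous (fun x => g (f x)).
  by move=> fc gc x; apply: continuous_comp; [exact: fc|exact: gc].
exists E, P; split=> //.
- have [d d0 LQ0] := resolvent_equiv Lc resQ0 resL.
  exists d => // z; rewrite -subr_le0.
  have : closed [set z | `|z| - d * `|E z| <= 0].
    apply: (closed_comp (f := fun z => `|z| - d * `|E z|)) (@closed_le R 0) => {}z _.
    apply: cvgB; first exact: norm_continuous.
    by apply: cvgMr; apply: cvg_norm; exact: Ec.
  by move=> /(dense_range_ind jdense); apply=> x /=; rewrite subr_le0 jL Ej.
- by move=> x Xpx; rewrite Ej; exact: Q0pos.
- by move=> n x Xpx; rewrite Pj; apply: (coneZ (bl_cone blX)) => //; exact: Qpos.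
- move=> x; under eq_fun do rewrite Pj.
  exact: (resolvent_approximates C0T K0 growth (ltW wmu) resQ).
- move=> n; apply: (dense_range_eq jdense) => [||x].
  + by apply: (comp_cont _ _ _ _ _ (comp_cont _ _ _ _ _ (Pc n) jc) Ec).
  + by apply: (comp_cont _ _ _ _ _ (comp_cont _ _ _ _ _ Ec jc) (Pc n)).
  + by rewrite !Ej !Pj linearZ/= QQ0.
- move=> n m; apply: (dense_range_eq jdense) => [||x].
  + by apply: (comp_cont _ _ _ _ _ (comp_cont _ _ _ _ _ (Pc m) jc) (Pc n)).
  + by apply: (comp_cont _ _ _ _ _ (comp_cont _ _ _ _ _ (Pc n) jc) (Pc m)).
  + rewrite !Pj !linearZ/= !scalerA mulrC.
    by rewrite (resolvent_comm x (resQ n) (resQ m)).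
- move=> n x Xpx; rewrite !Ej Pj linearZ/=.
  (* The resolvent identity turns the difference to be shown positive into the positive operator
     [Q n]. *)
  suff -> : Q0 x - n.+1%:R *: Q0 (Q n x) = Q n x by exact: Qpos.
  rewrite [RHS](resolvent_identity x resQ0 (resQ n)).
  by rewrite opprD addNKr scaleNr.
Qed.

Theorem theorem4p1 (R : realType) (X : completeNormedModType R) (Xp : set X)
    (T : R -> {linear X -> X}) (lambda : R)
    (Xm1 : completeNormedModType R) (j : {linear X -> Xm1}) :
  banach_lattice Xp -> order_continuous_norm Xp ->
  C0_semigroup T -> positive_semigroup T Xp ->
  (forall z : R[i], gen_spectrum T z -> complex.Re z < lambda) ->
  extrapolation_space T lambda j ->
  let Xm1p : set Xm1 := closure (j @` Xp) in
  (exists (N : span_space Xm1p -> R) (HN : is_norm N),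
    [/\ equivalent_norms N (span_norm Xm1p),
        banach_lattice (E := renormed HN) (span_cone Xm1p),
        order_continuous_norm (E := renormed HN) (span_cone Xm1p)
      & KB_space Xp -> KB_space (E := renormed HN) (span_cone Xm1p)]) /\
  (exists k : {linear X -> span_space Xm1p},
    [/\ forall x, \val (k x) = j x,
        lattice_hom Xp (span_cone Xm1p) k
      & lattice_ideal (span_cone Xm1p) (range k)]).
Proof.
move=> blX ocX C0T Tpos spec extr /=.
have [E [P ra]] := resolvent_approximation_exists blX C0T Tpos spec extr.
split.
  exists (@span_lattice_norm _ _ _ Xp j E).
  exists (span_lattice_norm_is_norm blX ocX ra); split.
  - exact: (span_lattice_norm_equivalent blX ocX ra).
  - exact: renormed_banach_lattice.
  - exact: renormed_order_continuous.
  - exact: renormed_KB.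
exists (span_embed blX ra); split.
- exact: (span_embedK blX ra).
- exact: (span_embed_vsup blX ra).
- exact: (span_embed_ideal blX ocX ra).
Qed.
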